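(* Let $r>0$, $\sigma>0$, let $H:\mathbb{T}^d\times\mathbb{R}^d\to\mathbb{R}$ be $\mathcal{C}^1$ and convex in its second argument, and let $f:\mathbb{T}^d\times\mathcal{P}(\mathbb{T}^d)\to\mathbb{R}$ be continuous and monotone, i.e. $\langle f(\cdot,\mu)-f(\cdot,\nu),\mu-\nu\rangle\ge 0$ for all $\mu,\nu\in\mathcal{P}(\mathbb{T}^d)$. If $U$ and $V$ are two monotone solutions of the stationary master equation (SME), then there is a function $c:\mathcal{P}(\mathbb{T}^d)\to\mathbb{R}$ such that $U(x,m)=V(x,m)+c(m)$ for all $x\in\mathbb{T}^d$, $m\in\mathcal{P}(\mathbb{T}^d)$. Moreover, if a monotone solution $U$ of (SME) exists, then it is a monotone map: $\langle U(\cdot,\mu)-U(\cdot,\nu),\mu-\nu\rangle\ge0$ for all $\mu,\nu\in\mathcal{P}(\mathbb{T}^d)$.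
   Context: Notation. $d$ is an integer greater than $1$; $\mathbb{T}^d$ is the $d$-dimensional torus; $\mathcal{M}(\mathbb{T}^d)$ is the set of (finite signed) measures on $\mathbb{T}^d$; $\mathcal{P}(\mathbb{T}^d)$ is the set of probability measures, with the Monge–Kantorovich distance $\mathbf{d}_1(\mu,\nu)=\sup\{\int\phi\,d(\mu-\nu):\phi \text{ 1-Lipschitz}\}$. $\|\cdot\|_{2}$ is the $\mathcal{C}^2(\mathbb{T}^d)$ norm. $\langle\cdot,\cdot\rangle$ denotes duality: $\langle g,\mu\rangle=\int g\,d\mu$, and derivatives of measures are in the sense of distributions, so $\langle g,\mathrm{div}(bm)\rangle=-\int\nabla g\cdot b\,dm$ and $\langle g,\Delta m\rangle=\int\Delta g\,dm$. $D_pH$ is the gradient of $H$ in its second argument. $\mathcal{B}$ is the space of functions $U:\mathbb{T}^d\times\mathcal{P}(\mathbb{T}^d)\to\mathbb{R}$ that are globally continuous and satisfy $\sup_{m}\|U(\cdot,m)\|_2<\infty$ (in particular $U(\cdot,m)\in\mathcal{C}^2$ for each $m$). Stationary master equation (SME), on $\mathbb{T}^d\times\mathcal{P}(\mathbb{T}^d)$: $$rU-\sigma\Delta U+H(x,\nabla_xU)-\Big\langle\tfrac{\delta U}{\delta m}(x,m,\cdot),\mathrm{div}\big(D_pH(\cdot,\nabla_xU(\cdot,m))m\big)\Big\rangle-\sigma\Big\langle\tfrac{\delta U}{\delta m}(x,m,\cdot),\Delta m\Big\rangle=f(x,m).$$ Monotone solution of (SME): a function $U\in\mathcal{B}$ such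 that for any $\mathcal{C}^2$ function $\phi:\mathbb{T}^d\to\mathbb{R}$, any $\nu\in\mathcal{M}(\mathbb{T}^d)$ and any point $m_0\in\mathcal{P}(\mathbb{T}^d)$ of strict minimum of $m\mapsto\langle U(\cdot,m)-\phi,m-\nu\rangle$ on $\mathcal{P}(\mathbb{T}^d)$ (i.e. the value at $m_0$ is strictly smaller than at every other $m$), $$r\langle U,m_0-\nu\rangle+\langle-\sigma\Delta U+H(\cdot,\nabla_xU),m_0-\nu\rangle\ge\langle f(\cdot,m_0),m_0-\nu\rangle-\langle U-\phi,\mathrm{div}(D_pH(\cdot,\nabla_xU)m_0)\rangle-\sigma\langle\Delta(U-\phi),m_0\rangle,$$ where $U$ stands for $U(\cdot,m_0)$. (This definition involves no derivative of $U$ in $m$.) *)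

(* Defs.v *)
From HB Require Import structures.
From mathcomp Require Import all_boot all_order all_algebra generic_quotient.
From mathcomp Require Import all_classical all_reals all_analysis.
From mathcomp Require Import giry.

Set Implicit Arguments.
Unset Strict Implicit.
Unset Printing Implicit Defensive.

Import Order.TTheory GRing.Theory Num.Theory.
Import numFieldNormedType.Exports.

Local Open Scope quotient_scope.
Local Open Scope classical_set_scope.
Local Open Scope ring_scope.

Section calculus.
Context {R : realType}.

Definition dotp (d : nat) (p q : 'rV[R]_d) : R :=
  \sum_(i < d) p ord0 i * q ord0 i.

(* Euclidean norm; the library norm `|p| on 'rV[R]_d is the sup norm. *)
Definition enorm (d : nat) (p : 'rV[R]_d) : R := Num.sqrt (dotp p p).

Definition pderiv (d : nat) (i : 'I_d) (F : 'rV[R]_d -> R) : 'rV[R]_d -> R :=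
  'D_(delta_mx ord0 i) F.

(* Only used for finite-dimensional V, where continuity of all directional
   derivatives is continuity of the differential. *)
Definition C1 (V : normedModType R) (F : V -> R) : Prop :=
  (forall x, differentiable F x) /\ (forall v, continuous ('D_v F)).

Definition C2 (V : normedModType R) (F : V -> R) : Prop :=
  C1 F /\ (forall v, C1 ('D_v F)).

End calculus.

Definition lattice_eq (R : realType) (d : nat) (x y : 'rV[R]_d) : bool :=
  [forall i, x ord0 i - y ord0 i \is a Num.int].

Lemma lattice_eq_refl (R : realType) (d : nat) : reflexive (@lattice_eq R d).
Proof. by move=> x; apply/forallP => i; rewrite subrr. Qed.

Lemma lattice_eq_sym (R : realType) (d : nat) : symmetric (@lattice_eq R d).
Proof.
by move=> x y; apply/forallP/forallP => h i; rewrite -opprB rpredN.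
Qed.

Lemma lattice_eq_trans (R : realType) (d : nat) : transitive (@lattice_eq R d).
Proof.
move=> y x z /forallP xy /forallP yz; apply/forallP => i.
by rewrite -(subrKA (y ord0 i)) rpredD.
Qed.

Canonical lattice_equiv (R : realType) (d : nat) :=
  EquivRel (@lattice_eq R d) (@lattice_eq_refl R d) (@lattice_eq_sym R d)
           (@lattice_eq_trans R d).

(* The torus R^d / Z^d with its quotient topology and Borel sigma-algebra. *)
Definition torus (R : realType) (d : nat) : Type :=
  quotient_topology {eq_quot (@lattice_eq R d)}.

HB.instance Definition _ (R : realType) (d : nat) :=
  PointedTopological.copy (torus R d)
    (quotient_topology {eq_quot (@lattice_eq R d)}).
HB.instance Definition _ (R : realType) (d : nat) :=
  EqQuotient.copy (torus R d) {eq_quot (@lattice_eq R d)}.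
HB.instance Definition _ (R : realType) (d : nat) :=
  Measurable.copy (torus R d) (g_sigma_algebraType (@open (torus R d))).

Section torus_functions.
Context {R : realType} {d : nat}.
Local Notation T := (torus R d).
Implicit Types (g phi : T -> R) (x y : T).

Definition tdist x y : R :=
  inf [set enorm (ab.1 - ab.2) |
       ab in [set ab : 'rV[R]_d * 'rV[R]_d |
              \pi_T ab.1 = x /\ \pi_T ab.2 = y]].

Definition lip1 phi : Prop :=
  forall x y, `|phi x - phi y| <= tdist x y.

Definition tlift g : 'rV[R]_d -> R := fun a => g (\pi_T a).

Definition torusC2 g : Prop := C2 (tlift g).

(* tlift g is periodic, so the value does not depend on the representative. *)
Definition tpderiv (i : 'I_d) g : T -> R :=
  fun x => pderiv i (tlift g) (repr x).

Definition tgrad g x : 'rV[R]_d := \row_i tpderiv i g x.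

Definition tlaplacian g : T -> R :=
  fun x => \sum_(i < d) tpderiv i (tpderiv i g) x.

Definition tsupnorm g : \bar R := ereal_sup [set (`|g x|)%:E | x in [set: T]].

Definition C2norm g : \bar R :=
  (tsupnorm g + \sum_(i < d) tsupnorm (tpderiv i g)
   + \sum_(i < d) \sum_(j < d) tsupnorm (tpderiv i (tpderiv j g)))%E.

Definition hamiltonianC1 (H : T -> 'rV[R]_d -> R) : Prop :=
  C1 (fun z : 'rV[R]_d * 'rV[R]_d => H (\pi_T z.1) z.2).

Definition DpH (H : T -> 'rV[R]_d -> R) x (p : 'rV[R]_d) : 'rV[R]_d :=
  \row_i pderiv i (H x) p.

End torus_functions.

Definition prob (R : realType) (d : nat) : Type := probability (torus R d) R.

HB.instance Definition _ (R : realType) (d : nat) := Pointed.on (prob R d).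

Section measures.
Context {R : realType} {d : nat}.
Local Notation T := (torus R d).
Local Notation P := (prob R d).
Implicit Types (g phi : T -> R) (m mu nu : P).

Definition pairing g m : R := \int[m]_x g x.

(* Integral against a signed measure through its Jordan decomposition, which
   does not depend on the chosen Hahn decomposition. *)
Definition cpairing g (nu : {charge set T -> \bar R}) : R :=
  let: exist p Hp := cid (Hahn_decomposition nu) in
  let: exist n pn := cid Hp in
  \int[jordan_pos pn]_x g x - \int[jordan_neg pn]_x g x.

(* <g, mu - nu>, for nu a probability measure and for nu a signed measure *)
Definition pairing_sub g mu nu : R := pairing g mu - pairing g nu.

Definition pairing_csub g m (nu : {charge set T -> \bar R}) : R :=
  pairing g m - cpairing g nu.

(* <g, div (b m)> and <g, Delta m>, in the sense of distributions *)
Definition pairing_div g (b : T -> 'rV[R]_d) m : R :=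
  - pairing (fun x => dotp (tgrad g x) (b x)) m.

Definition pairing_laplacian g m : R := pairing (tlaplacian g) m.

Definition d1 mu nu : \bar R :=
  ereal_sup [set (pairing_sub phi mu nu)%:E | phi in [set phi | lip1 phi]].

Definition d1_ball mu (e : R) nu : Prop := (d1 mu nu < e%:E)%E.

Lemma pairingN g m : pairing (fun x => - g x) m = - pairing g m.
Proof.
rewrite /pairing /Rintegral integralE [in RHS]integralE.
rewrite (_ : (fun x => (- g x)%:E) = (\- (EFin \o g))%E)//.
rewrite funeposN funenegN.
have := @integral_ge0 _ T R m setT _ (fun x _ => funepos_ge0 (EFin \o g) x).
have := @integral_ge0 _ T R m setT _ (fun x _ => funeneg_ge0 (EFin \o g) x).
by case: (integral _ _ _) => [a||]// _; case: (integral _ _ _) => [b||]// _ /=;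
  rewrite ?oppr0// opprB.
Qed.

Lemma d1_ball_center mu (e : R) : 0 < e -> d1_ball mu e mu.
Proof.
move=> e0; apply: le_lt_trans (_ : (0 < _)%E); last by rewrite lte_fin.
by apply: ub_ereal_sup => _ [phi _ <-]; rewrite /pairing_sub subrr.
Qed.

Lemma d1_sym mu nu : d1 mu nu = d1 nu mu.
Proof.
congr ereal_sup; apply/seteqP; split=> _ [phi lphi <-];
  (exists (fun x => - phi x); first by
    move=> x y; rewrite -opprD normrN; exact: lphi);
  by rewrite /pairing_sub !pairingN opprK addrC.
Qed.

Lemma d1_ball_sym mu nu (e : R) : d1_ball mu e nu -> d1_ball nu e mu.
Proof. by rewrite /d1_ball d1_sym. Qed.

Lemma d1_ball_triangle mu nu m (e1 e2 : R) :
  d1_ball mu e1 nu -> d1_ball nu e2 m -> d1_ball mu (e1 + e2) m.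
Proof.
move=> h1 h2; rewrite /d1_ball EFinD.
apply: le_lt_trans (lteD h1 h2).
apply: ub_ereal_sup => _ [phi lphi <-].
rewrite /pairing_sub -(subrKA (pairing phi nu)) EFinD.
by apply: leeD; apply: ereal_sup_ubound; exists phi.
Qed.

End measures.

HB.instance Definition _ (R : realType) (d : nat) :=
  hasNbhs.Build (prob R d) (nbhs_ (entourage_ (@d1_ball R d))).
HB.instance Definition _ (R : realType) (d : nat) :=
  Nbhs_isPseudoMetric.Build R (prob R d) erefl (@d1_ball_center R d)
    (@d1_ball_sym R d) (@d1_ball_triangle R d) erefl.

Section master_equation.
Context {R : realType} {d : nat}.
Local Notation T := (torus R d).
Local Notation P := (prob R d).
Implicit Types (f U : T -> P -> R).

Definition jointly_continuous f : Prop :=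
  continuous (fun z : T * P => f z.1 z.2).

Definition monotone_map f : Prop :=
  forall mu nu : P, 0 <= pairing_sub (fun x => f x mu - f x nu) mu nu.

Definition class_B U : Prop :=
  [/\ jointly_continuous U,
      forall m, torusC2 (U ^~ m) &
      (ereal_sup [set C2norm (U ^~ m) | m in [set: P]] < +oo)%E].

(* A measure of the library is a function on all sets, so points of P are to be
   distinguished by their values on measurable sets, not by Leibniz equality. *)
Definition strict_min (F : P -> R) (m0 : P) : Prop :=
  forall m : P, ~ measure_eq m m0 -> F m0 < F m.

Definition monotone_solution (r sigma : R) (H : T -> 'rV[R]_d -> R) f U
  : Prop :=
  class_B U /\
  forall (phi : T -> R) (nu : {charge set T -> \bar R}) (m0 : P),
    torusC2 phi ->
    strict_min (fun m => pairing_csub (fun x => U x m - phi x) m nu) m0 ->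
    let u := U ^~ m0 in
    let u_phi := fun x => u x - phi x in
    pairing_csub (f ^~ m0) m0 nu
      - pairing_div u_phi (fun x => DpH H x (tgrad u x)) m0
      - sigma * pairing_laplacian u_phi m0
    <= r * pairing_csub u m0 nu
       + pairing_csub
           (fun x => - sigma * tlaplacian u x + H x (tgrad u x)) m0 nu.

End master_equation.

(* Main.v *)
(* With W(mu, nu) = <U(., mu) - V(., nu), mu - nu>, the heart of the matter is
   W >= 0.  Let Q(m) be the weighted sum of the squares of the integrals against m
   of countably many smooth functions that separate probability measures, and let
   (mu, nu) minimise W - e (Q(mu) + Q(nu)) on the compact space P x P.  Completing
   the square, mu is a strict minimum of W(., nu) minus e times a linear
   functional with smooth density, so it is an admissible test point for U;
   likewise nu for V.  In the sum of the two inequalities the second order terms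
   cancel, monotonicity of f and convexity of H give signs, and the perturbation
   contributes O(e): hence r W(mu, nu) >= - O(e), so that W >= 0.
   Taking V = U gives monotonicity.  Taking mu = (1 - t) nu + t eta, dividing by t
   and letting t -> 0 gives <U(., nu) - V(., nu), eta - nu> >= 0 for every eta,
   and, exchanging U and V, equality; Dirac masses eta conclude.
   Compactness of P is obtained by realising all measures as laws of random points
   on one probability space, through quantiles along nested partitions. *)

Require Import Defs.
From HB Require Import structures.
From mathcomp Require Import all_boot all_order all_algebra generic_quotient.
From mathcomp Require Import all_classical all_reals all_analysis.
From mathcomp Require Import measurable_realfun giry ring lra.

Set Implicit Arguments.
Unset Strict Implicit.
Unset Printing Implicit Defensive.

Import Order.TTheory GRing.Theory Num.Theory.
Import numFieldNormedType.Exports.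
Local Open Scope quotient_scope.
Local Open Scope classical_set_scope.
Local Open Scope ring_scope.

(** The test functions of the definition depend on [x] only, so a perturbation that makes a minimum
    strict must be linear in the measure. The sign of the perturbation is what permits this: at a
    minimum of F - e Q, the functional Q may be replaced by its tangent at [mu], and the remainder e
    Q(m - mu) is left over in favour of strictness; with + e Q it would have the opposite sign. It
    vanishes only when [m] and [mu] agree on measurable sets, which is the notion of distinctness in
    [strict_min]. The minimiser moves with e, and no limit of minimisers is studied: a hypothetical
    negative value of W fixes e, and only bounds uniform in the measures enter. They come from the
    C^2 bound in [class_B], which confines all gradients to a box where the gradient of H is
    bounded, and from the normalisation of the separating functions, whose derivatives are bounded
    by one whatever their index. *)

Section euclidean_norm.
Context {R : realType} {d : nat}.
Implicit Types u v w : 'rV[R]_d.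

Lemma dotpp_ge0 v : 0 <= dotp v v.
Proof. by apply: sumr_ge0 => i _; rewrite -expr2 sqr_ge0. Qed.

Lemma coord_le_enorm v i : `|v ord0 i| <= enorm v.
Proof.
rewrite /enorm -sqrtr_sqr ler_sqrt ?dotpp_ge0//.
rewrite /dotp (bigD1 i)//= -expr2 lerDl.
by apply: sumr_ge0 => j _; rewrite -expr2 sqr_ge0.
Qed.

Lemma enorm_le_sum v : enorm v <= \sum_i `|v ord0 i|.
Proof.
have s0 : 0 <= \sum_i `|v ord0 i| by apply: sumr_ge0.
rewrite -(ger0_norm s0) -sqrtr_sqr /enorm ler_sqrt ?sqr_ge0//.
rewrite /dotp expr2 mulr_suml ler_sum// => i _.
rewrite -expr2 -real_normK ?num_real// expr2 ler_wpM2l//.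
by rewrite (bigD1 i)//= lerDl sumr_ge0.
Qed.

Lemma coord_le_norm v i : `|v ord0 i| <= `|v|.
Proof.
rewrite [leRHS]mx_normrE.
exact: (le_bigmax _ (fun ij : 'I_1 * 'I_d => `|v ij.1 ij.2|) (ord0, i)).
Qed.

Lemma enorm_le_norm v : enorm v <= d%:R * `|v|.
Proof.
apply: le_trans (enorm_le_sum v) _.
apply: le_trans (ler_sum _ (fun i _ => coord_le_norm v i)) _.
by rewrite sumr_const card_ord mulr_natl.
Qed.

Lemma dotp_addl u v w : dotp (u + v) w = dotp u w + dotp v w.
Proof. by rewrite /dotp -big_split/=; apply: eq_bigr => i _; rewrite mxE mulrDl. Qed.

Lemma dotp_scalel c u w : dotp (c *: u) w = c * dotp u w.
Proof. by rewrite /dotp mulr_sumr; apply: eq_bigr => i _; rewrite mxE mulrA. Qed.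

Lemma dotpC u w : dotp u w = dotp w u.
Proof. by apply: eq_bigr => i _; rewrite mulrC. Qed.

Lemma dotp_le_enorm u v : dotp u v <= enorm u * enorm v.
Proof.
have cs : dotp u v ^+ 2 <= dotp u u * dotp v v.
  (* This vector is [dotp v v] times the component of [u] orthogonal to [v]. Its square is
     [dotp v v] times the defect in the inequality, hence the separate case of a null [v]. *)
  have := dotpp_ge0 (dotp v v *: u + (- dotp u v) *: v).
  rewrite !(dotp_addl, dotp_scalel) ![dotp _ (_ + _)]dotpC.
  rewrite !(dotp_addl, dotp_scalel) (dotpC v u).
  rewrite [X in 0 <= X](_ : _ =
    dotp v v * (dotp u u * dotp v v - dotp u v ^+ 2)); last by ring.
  have [v0|v0] := eqVneq (dotp v v) 0.
    rewrite v0 mulr0 => _.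
    suff -> : dotp u v = 0 by rewrite expr0n.
    apply: big1 => i _; suff -> : v ord0 i = 0 by rewrite mulr0.
    apply/eqP; rewrite -normr_le0 (le_trans (coord_le_enorm v i))//.
    by rewrite /enorm v0 sqrtr0.
  by rewrite pmulr_rge0 ?subr_ge0// lt_neqAle eq_sym v0 dotpp_ge0.
rewrite /enorm -sqrtrM ?dotpp_ge0// (le_trans (ler_norm _))//.
by rewrite -sqrtr_sqr ler_wsqrtr.
Qed.

Lemma enormD u v : enorm (u + v) <= enorm u + enorm v.
Proof.
have h : 0 <= enorm u + enorm v by rewrite addr_ge0 ?sqrtr_ge0.
rewrite -(ger0_norm h) -sqrtr_sqr {1}/enorm ler_sqrt ?sqr_ge0//.
rewrite !(dotp_addl, dotp_scalel) ![dotp _ (_ + _)]dotpC !dotp_addl.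
rewrite (dotpC v u) sqrrD !sqr_sqrtr ?dotpp_ge0//.
by have := dotp_le_enorm u v; lra.
Qed.

Lemma enormN v : enorm (- v) = enorm v.
Proof.
by congr Num.sqrt; apply: eq_bigr => i _; rewrite !mxE mulrNN.
Qed.

End euclidean_norm.

(** * Topology and distance of the torus *)

Section torus_topology.
Context {R : realType} {d : nat}.
Local Notation T := (torus R d).
Implicit Types (g phi : T -> R) (x y : T) (a b : 'rV[R]_d).

Lemma torus_piP a b :
  (\pi_T a = \pi_T b) <-> forall i, a ord0 i - b ord0 i \is a Num.int.
Proof.
split=> [/eqmodP /forallP //|h].
by apply/eqmodP; apply/forallP.
Qed.

Lemma continuous_torusP (S : topologicalType) (g : T -> S) :
  continuous g <-> continuous (fun a => g (\pi_T a)).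
Proof. exact: quotient_continuous. Qed.

Lemma torus_repr_unit x :
  exists2 a, \pi_T a = x & forall i, 0 <= a ord0 i <= 1.
Proof.
exists (\row_i (repr x ord0 i - (Num.floor (repr x ord0 i))%:~R)).
  rewrite -[RHS]reprK; apply/torus_piP => i.
  by rewrite mxE addrC addrA addNr add0r rpredN intr_int.
move=> i; rewrite mxE; have := Num.Theory.floor_itv (repr x ord0 i).
by case/andP=> h1 h2; rewrite subr_ge0 h1 lerBlDl ltW// -intrD1.
Qed.

Lemma torus_compact : compact [set: T].
Proof.
have -> : [set: T] = (fun a : 'rV[R]_d => \pi_T a) @`
    [set a : 'rV[R]_d | forall i : 'I_d, `[0, 1]%classic (a ord0 i)].
  apply/seteqP; split=> // x _; have [a <- ha] := torus_repr_unit x.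
  by exists a => // i; rewrite /= in_itv/=.
apply: continuous_compact.
  by apply: continuous_subspaceT; exact: pi_continuous.
by apply: (@rV_compact R d (fun=> `[0, 1]%classic)) => i; exact: segment_compact.
Qed.

Lemma torus_bounded g : continuous g -> exists M, forall x, `|g x| <= M.
Proof.
move=> cg.
have /compact_bounded : compact (g @` [set: T]).
  by apply: continuous_compact; [exact: continuous_subspaceT|exact: torus_compact].
move=> /ex_strict_bound_gt0[M M0 /= hM].
by exists M => x; apply/ltW/hM; exists x.
Qed.

Lemma continuous_torus_measurable g : continuous g -> measurable_fun setT g.
Proof.
move=> /continuousP cg.
apply: (measurability _ (measurable_realfun.RGenOpens.measurableE R)).
move=> _ [_ [a [b ->]] <-]; rewrite setTI.
by apply: sub_sigma_algebra; apply: cg; exact: interval_open.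
Qed.

Lemma tdist_set_nonempty x y : [set enorm (ab.1 - ab.2) |
       ab in [set ab : 'rV[R]_d * 'rV[R]_d |
              \pi_T ab.1 = x /\ \pi_T ab.2 = y]] !=set0.
Proof. by exists (enorm (repr x - repr y)), (repr x, repr y); rewrite //= !reprK. Qed.

Lemma tdist_set_lb x y : lbound [set enorm (ab.1 - ab.2) |
       ab in [set ab : 'rV[R]_d * 'rV[R]_d |
              \pi_T ab.1 = x /\ \pi_T ab.2 = y]] 0.
Proof. by move=> _ [ab _ <-]; exact: sqrtr_ge0. Qed.

Lemma tdist_lb x y (c : R) :
  (forall a b, \pi_T a = x -> \pi_T b = y -> c <= enorm (a - b)) -> c <= tdist x y.
Proof.
move=> h; apply: lb_le_inf; first exact: tdist_set_nonempty.
by move=> _ [ab [h1 h2] <-]; exact: h.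
Qed.

Lemma tdist_ge0 x y : 0 <= tdist x y.
Proof. by apply: tdist_lb => a b _ _; exact: sqrtr_ge0. Qed.

Lemma tdist_pi_le a b : tdist (\pi_T a) (\pi_T b) <= enorm (a - b).
Proof.
apply: ge_inf; first by exists 0; exact: tdist_set_lb.
by exists (a, b).
Qed.

(** Translating the second point by [a - b] turns a pair of representatives of [x] and the class of
    [b] into one of [x] and the class of [a]. *)
Lemma tdist_pi_lip x a b :
  `|tdist x (\pi_T a) - tdist x (\pi_T b)| <= enorm (a - b).
Proof.
wlog suff h : a b / tdist x (\pi_T a) - tdist x (\pi_T b) <= enorm (a - b).
  rewrite ler_norml h andbT lerNl opprB (le_trans (h b a))//.
  by rewrite -enormN opprB.
rewrite lerBlDl -lerBlDr; apply: tdist_lb => p q px qb.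
rewrite lerBlDr.
apply: (@le_trans _ _ (tdist (\pi_T p) (\pi_T (q + (a - b))))).
  rewrite px.
  suff -> : \pi_T (q + (a - b)) = \pi_T a :> T by [].
  apply/torus_piP => i; move/torus_piP : qb => /(_ i).
  by rewrite !mxE [_ + _ - _](_ : _ = q ord0 i - b ord0 i)//; ring.
apply: le_trans (tdist_pi_le _ _) _.
rewrite opprD addrA; apply: le_trans (enormD _ _) _.
by rewrite enormN.
Qed.

Lemma tdistxx x : tdist x x = 0.
Proof.
apply/eqP; rewrite eq_le tdist_ge0 andbT.
rewrite -[x]reprK (le_trans (tdist_pi_le _ _))// subrr.
by rewrite /enorm /dotp big1 ?sqrtr0// => i _; rewrite !mxE mul0r.
Qed.

Lemma tdist_le_dim x y : tdist x y <= d%:R.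
Proof.
have [a <- ha] := torus_repr_unit x; have [b <- hb] := torus_repr_unit y.
apply: le_trans (tdist_pi_le _ _) _; apply: le_trans (enorm_le_sum _) _.
apply: (@le_trans _ _ (\sum_(i < d) (1 : R))).
  apply: ler_sum => i _; rewrite !mxE ler_norml.
  by move: (ha i) (hb i) => /andP[? ?] /andP[? ?]; apply/andP; split; lra.
by rewrite sumr_const card_ord.
Qed.

Lemma lipschitz_continuous (g : 'rV[R]_d -> R) (K : R) :
  (forall a b, `|g a - g b| <= K * enorm (a - b)) -> continuous g.
Proof.
move=> h a; apply/(@cvgrPdist_le _ _ _ (nbhs a)) => e e0.
pose L := `|K| * d%:R + 1.
have L0 : 0 < L by rewrite ltr_wpDl// mulr_ge0.
apply/nbhs_ballP; exists (e / L) => /=; first exact: divr_gt0.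
move=> b; rewrite mx_norm_ball /ball_/= => /ltW hb.
rewrite (le_trans (h _ _))//.
apply: (@le_trans _ _ (`|K| * (d%:R * `|a - b|))).
  apply: (@le_trans _ _ (`|K| * enorm (a - b))).
    by rewrite ler_wpM2r ?sqrtr_ge0// ler_norm.
  by rewrite ler_wpM2l// enorm_le_norm.
rewrite mulrA; apply: (@le_trans _ _ (L * `|a - b|)).
  by rewrite ler_wpM2r// /L lerDl.
by rewrite mulrC -ler_pdivlMr.
Qed.

Lemma tdist_continuous x : continuous (tdist x).
Proof.
apply/continuous_torusP; apply: (@lipschitz_continuous _ 1) => a b.
by rewrite mul1r tdist_pi_lip.
Qed.

Definition torus_lip (K : R) g := forall x y, `|g x - g y| <= K * tdist x y.

Lemma torus_lipP (K : R) g : 0 <= K ->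
  (forall a b, `|g (\pi_T a) - g (\pi_T b)| <= K * enorm (a - b)) ->
  torus_lip K g.
Proof.
rewrite le_eqVlt => /predU1P[<- h x y|K0 h x y].
  by rewrite -[x]reprK -[y]reprK (le_trans (h _ _))// !mul0r.
rewrite mulrC -ler_pdivrMr//; apply: tdist_lb => a b <- <-.
by rewrite ler_pdivrMr// mulrC.
Qed.

Lemma torus_lip_continuous (K : R) g : 0 <= K -> torus_lip K g -> continuous g.
Proof.
move=> K0 h; apply/continuous_torusP; apply: (@lipschitz_continuous _ K) => a b.
by rewrite (le_trans (h _ _))// ler_wpM2l// tdist_pi_le.
Qed.

Lemma lip1_continuous g : lip1 g -> continuous g.
Proof.
by move=> h; apply: (@torus_lip_continuous 1) => // x y; rewrite mul1r.
Qed.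

End torus_topology.

(** * Functions with bounded derivatives *)

Section directional_derivatives.
Context {R : realType} {d : nat}.
Local Notation V := 'rV[R]_d.
Implicit Types (g : V -> R) (a h v : V).

Definition linform (l : 'I_d -> R) (h : V) : R := \sum_i h ord0 i * l i.

Lemma linform_is_linear l : linear (linform l).
Proof.
move=> c u v; rewrite /linform scaler_sumr -big_split/=; apply: eq_bigr => i _.
by rewrite !mxE mulrDl /GRing.scale/= mulrA.
Qed.

HB.instance Definition _ l :=
  GRing.isLinear.Build R V R _ (linform l) (linform_is_linear l).

Lemma linform_continuous l : continuous (linform l).
Proof.
apply: (@lipschitz_continuous _ _ _ (\sum_i `|l i|)) => a b.
rewrite -linearB/= /linform (le_trans (ler_norm_sum _ _ _))//.
rewrite mulr_suml ler_sum// => i _; rewrite normrM mulrC ler_wpM2l//.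
exact: coord_le_enorm.
Qed.

Lemma linform_delta l i : linform l (delta_mx ord0 i) = l i.
Proof.
rewrite /linform (bigD1 i)//= mxE !eqxx mul1r big1 ?addr0// => j ji.
by rewrite mxE (negbTE ji) andbF mul0r.
Qed.

(** A quadratic remainder is a little-o of the increment, so it yields differentiability and
    identifies the differential at once. This suits functions known through an integral, whose
    difference quotients are not directly accessible. *)
Lemma differentiable_quadratic g a l (C : R) :
  (forall h, `|g (a + h) - g a - linform l h| <= C * `|h| ^+ 2) ->
  differentiable g a /\ 'd g a = linform l :> (V -> R).
Proof.
move=> hC.
have e : g \o shift a = cst (g a) + (linform l : V -> R) +o_ (0 : V) id.
  apply/eqaddoP => e e0.
  have C0 : 0 < `|C| + 1 by rewrite ltr_wpDl.
  apply/nbhs_ballP; exists (e / (`|C| + 1)) => /=; first exact: divr_gt0.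
  move=> h; rewrite mx_norm_ball /ball_/= sub0r normrN => hh.
  rewrite [X in `|X|](_ : _ = g (a + h) - g a - linform l h); last first.
    by rewrite [a + h]addrC -[LHS]/(g (h + a) - (g a + linform l h)) opprD addrA.
  apply: le_trans (hC h) _; rewrite expr2 mulrA ler_wpM2r//.
  apply: (@le_trans _ _ ((`|C| + 1) * `|h|)).
    by rewrite ler_wpM2r// (le_trans (ler_norm _))// lerDl.
  by rewrite mulrC -ler_pdivlMr// ltW.
have dE : 'd g a = linform l :> (V -> R).
  by apply: diff_unique => //; exact: linform_continuous.
by split=> //; apply/diff_locallyP; rewrite dE; split => //; exact: linform_continuous.
Qed.

Lemma derive_linform g a v : differentiable g a ->
  'D_v g a = linform (fun i => pderiv i g a) v.
Proof.
move=> dg; rewrite deriveE// {1}(row_sum_delta v) linear_sum/=.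
by apply: eq_bigr => i _; rewrite linearZ /pderiv deriveE.
Qed.

Lemma MVT_segment_rV g a h : (forall x, differentiable g x) ->
  exists2 c : R, 0 <= c <= 1 & g (a + h) - g a = 'D_h g (a + c *: h).
Proof.
move=> dg; pose f (t : R) := g (a + t *: h).
have E (t : R) : (fun s : R => s^-1 *: ((f \o shift t) (s *: (1 : R)) - f t)) =
    (fun s : R => s^-1 *: ((g \o shift (a + t *: h)) (s *: h) - g (a + t *: h))).
  apply/funext => s; rewrite /f /shift/= scalerDl addrCA.
  by rewrite [s *: (1 : R)]mulr1.
have df (t : R) : is_derive t 1 f ('D_h g (a + t *: h)).
  have := @diff_derivable _ _ _ g _ h (dg (a + t *: h)).
  by rewrite /derivable -E => dft; apply: DeriveDef => //; rewrite /derive E.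
have [|c c01] := @MVT_segment R f (fun t => 'D_h g (a + t *: h)) 0 1 ler01
  (fun t _ => df t).
  apply: continuous_subspaceT => t; apply: differentiable_continuous.
  by apply/derivable1_diffP; have [] := df t.
rewrite /f scale1r scale0r addr0 subr0 mulr1 => ->.
by exists c => //; move: c01; rewrite in_itv.
Qed.

End directional_derivatives.

Section bounded_derivatives.
Context {R : realType} {d : nat}.
Local Notation V := 'rV[R]_d.
Implicit Types (g : V -> R) (a h v : V).

(** Derivatives of order [k] are bounded but not assumed continuous. A common [M] for all orders
    expresses uniformity over a family of functions. *)
Fixpoint bnd (k : nat) (M : R) (g : V -> R) : Prop :=
  (forall a, `|g a| <= M) /\
  if k is k'.+1 then
    (forall a, differentiable g a) /\ forall i, bnd k' M (pderiv i g)
  else True.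

Lemma bnd0 k M g a : bnd k M g -> `|g a| <= M.
Proof. by case: k => [|k] []. Qed.

Lemma bndSP k M g : bnd k.+1 M g -> [/\ forall a, `|g a| <= M,
  forall a, differentiable g a & forall i, bnd k M (pderiv i g)].
Proof. by case=> ? []. Qed.

Lemma bnd_ge0 k M g : bnd k M g -> 0 <= M.
Proof. by move=> /(@bnd0 _ _ _ 0); apply: le_trans. Qed.

Lemma bndS k M g : bnd k.+1 M g -> bnd k M g.
Proof.
elim: k M g => [|k ih] M g; first by case.
by case=> h1 [h2 h3]; split => //; split => // i; apply/ih/h3.
Qed.

Lemma bnd_le k M N g : M <= N -> bnd k M g -> bnd k N g.
Proof.
move=> MN; elim: k g => [|k ih] g; first by case=> h _; split=> // a; apply: le_trans MN.
case/bndSP=> h1 h2 h3; split; first by move=> a; apply: le_trans MN.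
by split => // i; apply/ih/h3.
Qed.

Lemma bnd_cst k c : bnd k `|c| (cst c : V -> R).
Proof.
elim: k c => [|k ih] c; first by [].
split=> //; split=> [a|i]; first exact: differentiable_cst.
have -> : pderiv i (cst c : V -> R) = cst 0.
  by apply/funext => a; rewrite /pderiv derive_cst.
by apply: (bnd_le _ (ih 0)); rewrite normr0.
Qed.

Lemma bndD k M N f g : bnd k M f -> bnd k N g -> bnd k (M + N) (fun a => f a + g a).
Proof.
elim: k f g => [|k ih] f g.
  by move=> [hf _] [hg _]; split=> // a; rewrite (le_trans (ler_normD _ _))// lerD.
move=> /bndSP[hf df pf] /bndSP[hg dg pg]; split.
  by move=> a; rewrite (le_trans (ler_normD _ _))// lerD.
split=> [a|i]; first exact: differentiableD.
have -> : pderiv i (fun a => f a + g a) = fun a => pderiv i f a + pderiv i g a.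
  by apply/funext => a; rewrite /pderiv deriveD//; exact: diff_derivable.
exact: ih.
Qed.

(** By the Leibniz rule each derivative doubles the number of products, all of them bounded by
    [M * N]; hence the power of two. *)
Lemma bndM k M N f g : bnd k M f -> bnd k N g ->
  bnd k (2 ^+ k * (M * N)) (fun a => f a * g a).
Proof.
elim: k M N f g => [|k ih] M N f g.
  by move=> [hf _] [hg _]; split=> // a; rewrite mul1r normrM ler_pM.
move=> hf hg; have M0 := bnd_ge0 hf; have N0 := bnd_ge0 hg.
have := bndS hf; have := bndS hg => hg' hf'.
case/bndSP: hf hg => hf df pf /bndSP[hg dg pg]; split.
  move=> a; rewrite normrM (@le_trans _ _ (M * N))//; first exact: ler_pM.
  by rewrite ler_peMl ?mulr_ge0// exprn_ege1// ler1n.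
split=> [a|i]; first exact: differentiableM.
have -> : pderiv i (fun a => f a * g a) =
    fun a => f a * pderiv i g a + g a * pderiv i f a.
  apply/funext => a; rewrite /pderiv.
  by rewrite (@deriveM _ _ f g a _ (diff_derivable (df a)) (diff_derivable (dg a))).
rewrite exprS (_ : _ * _ = 2 ^+ k * (M * N) + 2 ^+ k * (N * M)); last by ring.
by apply: bndD; apply: ih.
Qed.

Lemma bndZ k M c g : bnd k M g -> bnd k (`|c| * M) (fun a => c * g a).
Proof.
elim: k g => [|k ih] g.
  by move=> [hg _]; split=> // a; rewrite normrM ler_wpM2l.
move=> /bndSP[hg dg pg]; split.
  by move=> a; rewrite normrM ler_wpM2l.
split=> [a|i]; first exact: (differentiableZ c).
have -> : pderiv i (fun a => c * g a) = fun a => c * pderiv i g a.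
  by apply/funext => a; rewrite /pderiv (deriveZ c)//; exact: diff_derivable.
exact: ih.
Qed.

(** The phase [th] makes the family stable under derivation: the derivative of the cosine is the
    cosine shifted by a quarter period, and the amplitude is multiplied by [w] or by 0. *)
Lemma bnd_cos k (A w th : R) (i : 'I_d) :
  bnd k (`|A| * (1 + `|w|) ^+ k) (fun a => A * cos (w * a ord0 i + th)).
Proof.
elim: k A th => [|k ih] A th.
  by split=> // a; rewrite mulr1 normrM ler_piMr// cos_max.
have dl (a : V) := @differentiable_quadratic R d (fun a : V => w * a ord0 i + th)
  a (fun j => w * (j == i)%:R) 0.
have lE (h : V) : linform (fun j => w * (j == i)%:R) h = w * h ord0 i.
  rewrite /linform (bigD1 i)//= eqxx mulr1 mulrC big1 ?addr0// => j /negbTE ->.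
  by rewrite !mulr0.
have {dl} [dl dlE] : (forall a : V, differentiable (fun a : V => w * a ord0 i + th) a)
    /\ forall a h : V, 'd (fun a : V => w * a ord0 i + th) a h = w * h ord0 i.
  split=> a; have [|d1 d2] := dl a.
  - move=> h; rewrite lE mxE mul0r normr_le0; apply/eqP; ring.
  - by [].
  - move=> h; rewrite lE mxE mul0r normr_le0; apply/eqP; ring.
  - by move=> h; rewrite d2 lE.
have dcos (x : R) : differentiable (@cos R) x by apply/derivable1_diffP.
have dg (a : V) : differentiable (fun a : V => cos (w * a ord0 i + th)) a.
  exact: (differentiable_comp (dl a)).
split.
  move=> a; rewrite normrM ler_wpM2l// (le_trans (cos_max _))//.
  by rewrite exprn_ege1// lerDl.
split=> [a|j]; first exact: (differentiableZ A).
have -> : pderiv j (fun a : V => A * cos (w * a ord0 i + th)) =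
    fun a => (A * w * (i == j)%:R) * cos (w * a ord0 i + (th + pi / 2)).
  apply/funext => a; rewrite /pderiv (deriveZ A); last exact: diff_derivable.
  rewrite deriveE// (@diff_comp _ _ _ _ (fun a : V => w * a ord0 i + th) cos)//=.
  rewrite dlE mxE eqxx/= addrA cosDpihalf deriv1E//.
  by rewrite derive1E derive_val /GRing.scale/=; ring.
apply: (bnd_le _ (ih _ _)).
rewrite !normrM -!mulrA ler_wpM2l// exprS.
have X0 : 0 <= (1 + `|w|) ^+ k by rewrite exprn_ge0 ?addr_ge0.
have w0 := normr_ge0 w.
by case: (i == j); rewrite ?normr1 ?normr0; nra.
Qed.

Lemma bnd_lip k M g : bnd k.+1 M g ->
  forall a b, `|g a - g b| <= M * \sum_i `|a ord0 i - b ord0 i|.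
Proof.
case/bndSP=> _ dg pg a b.
have [c _] := MVT_segment_rV b (a - b) dg.
rewrite [b + _]addrC subrK => ->; rewrite derive_linform// /linform mulr_sumr.
rewrite (le_trans (ler_norm_sum _ _ _))// ler_sum// => i _.
by rewrite !mxE mulrC normrM ler_wpM2r// (bnd0 _ (pg i)).
Qed.

(** The mean value theorem leaves the variation of the partial derivatives along the segment. Each
    varies by at most [M * d * |h|], and the coordinates of [h] sum to at most [d * |h|]. *)
Lemma bnd_taylor k M g : bnd k.+2 M g -> forall a h,
  `|g (a + h) - g a - linform (fun i => pderiv i g a) h|
    <= M * d%:R ^+ 2 * `|h| ^+ 2.
Proof.
move=> bg a h; have M0 := bnd_ge0 bg; case/bndSP: bg => _ dg pg.
have [c /andP[c0 c1]] := MVT_segment_rV a h dg.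
move=> ->; rewrite derive_linform// /linform -sumrB.
have sh : \sum_i `|h ord0 i| <= d%:R * `|h|.
  apply: le_trans (ler_sum _ (fun i _ => coord_le_norm h i)) _.
  by rewrite sumr_const card_ord mulr_natl.
apply: (@le_trans _ _ (\sum_(i < d) `|h ord0 i| * (M * (d%:R * `|h|)))).
  rewrite (le_trans (ler_norm_sum _ _ _))// ler_sum// => i _.
  rewrite -mulrBr normrM ler_wpM2l//.
  rewrite (le_trans (bnd_lip (pg i) _ _))// ler_wpM2l// (le_trans _ sh)//.
  apply: ler_sum => j _; rewrite !mxE [_ + _ - _]addrAC subrr add0r normrM.
  by rewrite ger0_norm// ler_piMl.
rewrite -mulr_suml; apply: (@le_trans _ _ (d%:R * `|h| * (M * (d%:R * `|h|)))).
  by rewrite ler_wpM2r// !mulr_ge0.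
by rewrite le_eqVlt; apply/orP; left; apply/eqP; ring.
Qed.

Lemma bnd_continuous k M g : bnd k.+1 M g -> continuous g.
Proof. by case/bndSP=> _ dg _ a; apply: differentiable_continuous. Qed.

Lemma bnd_sum (I : Type) (r : seq I) k (M : I -> R) (f : I -> V -> R) :
  (forall i, bnd k (M i) (f i)) ->
  bnd k (\sum_(i <- r) M i) (fun a => \sum_(i <- r) f i a).
Proof.
move=> h; elim: r => [|i r ih].
  rewrite big_nil (_ : (fun _ => _) = cst 0); last first.
    by apply/funext => a; rewrite big_nil.
  by have := bnd_cst k (0 : R); rewrite normr0.
rewrite big_cons (_ : (fun _ => _) = fun a => f i a + \sum_(i <- r) f i a).
  exact: bndD.
by apply/funext => a; rewrite big_cons.
Qed.

Lemma bnd_derive k M g v : bnd k.+1 M g -> exists N, bnd k N ('D_v g).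
Proof.
case/bndSP => _ dg pg; exists (\sum_i (`|v ord0 i| * M)).
have -> : 'D_v g = fun a => \sum_i v ord0 i * pderiv i g a.
  by apply/funext => a; rewrite derive_linform.
by apply: bnd_sum => i; exact: bndZ.
Qed.

(** Continuity of the first derivatives is deduced from their differentiability, which costs one
    more order. *)
Lemma bnd_C1 k M g : bnd k.+2 M g -> C1 g.
Proof.
move=> bg; split; first by case/bndSP : bg.
by move=> v; have [N /bnd_continuous] := bnd_derive v bg.
Qed.

Lemma bnd_C2 k M g : bnd k.+3 M g -> C2 g.
Proof.
move=> bg; split; first exact: bnd_C1 bg.
by move=> v; have [N /bnd_C1] := bnd_derive v bg.
Qed.

End bounded_derivatives.

(** * Integrals of bounded functions against a probability *)

Section bounded_integrals.
Context {d0} {Y : measurableType d0} {R : realType} (P : probability Y R).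
Implicit Types f g : Y -> R.

Lemma bounded_integrable f (M : R) : measurable_fun setT f ->
  (forall y, `|f y| <= M) -> P.-integrable setT (EFin \o f).
Proof.
move=> mf hM; apply: (le_integrable measurableT (g := EFin \o cst M)).
- exact/measurable_EFinP.
- by move=> y _ /=; rewrite lee_fin (le_trans (hM y))// ler_norm.
- exact: finite_measure_integrable_cst.
Qed.

Lemma integrable_addr f g : P.-integrable setT (EFin \o f) ->
  P.-integrable setT (EFin \o g) -> P.-integrable setT (EFin \o (fun y => f y + g y)).
Proof. by move=> hf hg; exact: (integrableD measurableT hf hg). Qed.

Lemma integrable_subr f g : P.-integrable setT (EFin \o f) ->
  P.-integrable setT (EFin \o g) -> P.-integrable setT (EFin \o (fun y => f y - g y)).
Proof. by move=> hf hg; exact: (integrableB measurableT hf hg). Qed.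

Lemma integrable_mulr c f : P.-integrable setT (EFin \o f) ->
  P.-integrable setT (EFin \o (fun y => c * f y)).
Proof. by move=> hf; exact: (integrableZl measurableT c hf). Qed.

Lemma Rintegral_cst_prob (c : R) : \int[P]_y c = c.
Proof. by rewrite Rintegral_cst//= probability_setT mulr1. Qed.

Lemma Rintegral_norm_le f (M : R) : measurable_fun setT f ->
  (forall y, `|f y| <= M) -> `|\int[P]_y f y| <= M.
Proof.
move=> mf hM; have fi := bounded_integrable mf hM.
rewrite (le_trans (le_normr_Rintegral measurableT fi))//.
rewrite -[leRHS]Rintegral_cst_prob; apply: le_Rintegral => //.
- by apply: (@bounded_integrable _ M) => [|y]; [exact: measurableT_comp|rewrite normr_id].
- by apply: (@bounded_integrable _ `|M|).
Qed.

Lemma Rintegral_sum (I : Type) (r : seq I) (F : I -> Y -> R) :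
  (forall i, P.-integrable setT (EFin \o F i)) ->
  P.-integrable setT (EFin \o (fun y => \sum_(i <- r) F i y)) /\
  \int[P]_y (\sum_(i <- r) F i y) = \sum_(i <- r) \int[P]_y F i y.
Proof.
move=> h; elim: r => [|i r [ih1 ih2]].
  split; last by under eq_Rintegral do rewrite big_nil; rewrite big_nil Rintegral_cst_prob.
  rewrite (_ : (fun _ => _) = cst 0).
    exact: finite_measure_integrable_cst.
  by apply/funext => y; rewrite big_nil.
have E : (fun y => \sum_(j <- i :: r) F j y) = fun y => F i y + \sum_(j <- r) F j y.
  by apply/funext => y; rewrite big_cons.
rewrite E; split; first exact: integrable_addr.
by rewrite RintegralD// ih2 big_cons.
Qed.

End bounded_integrals.

(** * Differentiation under the integral sign *)

Section integral_depending_on_parameter.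
Context {R : realType} {d : nat} (S : probability nat R).
Local Notation V := 'rV[R]_d.
Implicit Types (K : nat -> V -> R).

Lemma bnd_integrable K k M a : (forall n, bnd k M (K n)) ->
  S.-integrable setT (EFin \o (fun n => K n a)).
Proof. by move=> h; apply: (@bounded_integrable _ _ _ _ _ M) => // y; exact: bnd0 (h y). Qed.

(** The Taylor remainders of all [K n] are bounded by one and the same quadratic, and so is their
    average. *)
Lemma differentiable_Rintegral K k M a : (forall n, bnd k.+2 M (K n)) ->
  differentiable (fun a => \int[S]_n K n a) a /\
  forall i, pderiv i (fun a => \int[S]_n K n a) a = \int[S]_n pderiv i (K n) a.
Proof.
move=> h; pose l i := \int[S]_n pderiv i (K n) a.
have h1 i n : bnd k.+1 M (pderiv i (K n)) by case/bndSP : (h n).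
have lE v : S.-integrable setT (EFin \o (fun n => linform (fun i => pderiv i (K n) a) v)) /\
   \int[S]_n linform (fun i => pderiv i (K n) a) v = linform l v.
  have hi (i : 'I_d) : S.-integrable setT (EFin \o (fun n => v ord0 i * pderiv i (K n) a)).
    by apply: integrable_mulr; exact: bnd_integrable (h1 i).
  have [r1 r2] := Rintegral_sum (index_enum 'I_d) hi.
  split => //; rewrite r2; apply: eq_bigr => i _.
  by rewrite RintegralZl//; exact: bnd_integrable (h1 i).
have [|d1 d2] := @differentiable_quadratic R d (fun a => \int[S]_n K n a) a l (M * d%:R ^+ 2).
  move=> v; have [l1 l2] := lE v; rewrite -l2.
  have := bnd_integrable _ h => hi.
  rewrite -RintegralB// -RintegralB//; last exact: integrable_subr.
  apply: Rintegral_norm_le => // n; exact: bnd_taylor (h n) _ _.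
split=> // i; rewrite /pderiv deriveE// d2 linform_delta//.
Qed.

(** One order is lost because differentiability of the integral is read off a second-order
    remainder. *)
Lemma bnd_Rintegral K k M : (forall n, bnd k.+1 M (K n)) ->
  bnd k M (fun a => \int[S]_n K n a).
Proof.
elim: k K => [|k ih] K h.
  by split=> // a; apply: Rintegral_norm_le => // n; exact: bnd0 (h n).
split; first by move=> a; apply: Rintegral_norm_le => // n; exact: bnd0 (h n).
split=> [a|i]; first by have [] := differentiable_Rintegral a h.
rewrite (_ : pderiv i _ = fun a => \int[S]_n pderiv i (K n) a).
  by apply: ih => n; case/bndSP: (h n).
by apply/funext => a; have [_] := differentiable_Rintegral a h.
Qed.

End integral_depending_on_parameter.

(** * Triangle inequality and distance balls on the torus *)

Section torus_distance.
Context {R : realType} {d : nat}.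
Local Notation T := (torus R d).
Implicit Types (x y z : T).

Lemma tdistC x y : tdist x y = tdist y x.
Proof.
by apply/eqP; rewrite eq_le; apply/andP; split; apply: tdist_lb => a b <- <-;
  rewrite -enormN opprB; exact: tdist_pi_le.
Qed.

Lemma tdist_lip x : torus_lip 1 (tdist x).
Proof. by apply: torus_lipP => // a b; rewrite mul1r tdist_pi_lip. Qed.

Lemma tdist_triangle y x z : tdist x z <= tdist x y + tdist y z.
Proof.
rewrite -lerBlDl; apply: le_trans (ler_norm _) _.
by have := tdist_lip x z y; rewrite mul1r (tdistC z).
Qed.

(** The preimage of [O] contains a ball about a representative [a] of [x]. If representatives [p] of
    [x] and [q] of [z] are close, then [a + (q - p)] represents [z] and lies in that ball. *)
Lemma open_tdist_ball (O : set T) x : open O -> O x ->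
  exists2 e : R, 0 < e & forall z, tdist x z < e -> O z.
Proof.
move=> oO Ox; pose a := repr x.
have : nbhs a [set b : 'rV[R]_d | O (\pi_T b)].
  apply: (@pi_continuous _ _ a); apply: open_nbhs_nbhs; split => //.
  by rewrite /a reprK.
move=> /nbhs_ballP[e /= e0 he]; exists e => // z.
rewrite ltNge => /negP xz; apply: contrapT => Oz; apply: xz.
apply: tdist_lb => p q px qz; rewrite leNgt; apply/negP => pq; apply: Oz.
suff -> : z = \pi_T (a + (q - p)).
  apply: he; rewrite mx_norm_ball /ball_/= opprD addrA subrr sub0r normrN.
  rewrite [ltLHS]mx_normrE bigmax_lt// => -[i j] _ /=; rewrite (ord1 i).
  by apply: le_lt_trans (coord_le_enorm _ _) _; rewrite -enormN opprB.
rewrite -qz; apply/torus_piP => i.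
have /torus_piP /(_ i) : \pi_T p = \pi_T a :> T by rewrite px /a reprK.
by rewrite !mxE [X in _ -> X \is a _](_ : _ = p ord0 i - a ord0 i)//; ring.
Qed.

End torus_distance.

(** * Quantile coupling and compactness of the space of probability measures *)

Section dyadic_index.
Context {Y : Type} (A : nat -> set Y).

(* The first k answers to "is x in A n?", read as a binary number. *)
Fixpoint dyadic_index (k : nat) (x : Y) : nat :=
  if k is k'.+1 then (`[< A k' x >] + (dyadic_index k' x).*2)%N else 0%N.

Lemma dyadic_index_lt k x : (dyadic_index k x < 2 ^ k)%N.
Proof.
elim: k => //= k ih; rewrite expnS mul2n.
by case: asboolP; rewrite ?add1n ?add0n ?ltn_Sdouble ?ltn_double.
Qed.

Lemma dyadic_index_half k x : (dyadic_index k.+1 x)./2 = dyadic_index k x.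
Proof. by rewrite /= half_bit_double. Qed.

Lemma dyadic_index_eqW k n x y : (k <= n)%N -> dyadic_index n x = dyadic_index n y ->
  dyadic_index k x = dyadic_index k y.
Proof.
elim: n => [|n ih]; first by rewrite leqn0 => /eqP ->.
rewrite leq_eqVlt => /predU1P[-> //|kn] h; apply: ih => //.
by rewrite -[LHS]dyadic_index_half -[RHS]dyadic_index_half h.
Qed.

Lemma dyadic_index_eqP k x y : dyadic_index k x = dyadic_index k y ->
  forall n, (n < k)%N -> A n x <-> A n y.
Proof.
move=> h n nk; have := dyadic_index_eqW nk h => /= /(congr1 odd).
rewrite !oddD !odd_double !addbF !oddb => e.
by split=> /asboolP ax; apply/asboolP; [rewrite -e|rewrite e].
Qed.

End dyadic_index.

Section dyadic_index_measurable.
Context {d0} {Y : measurableType d0} (A : nat -> set Y).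

Lemma dyadic_index_measurable k j : (forall n, (n < k)%N -> measurable (A n)) ->
  measurable [set x | dyadic_index A k x = j].
Proof.
elim: k j => [|k ih] j mA.
  have [->|j0] := eqVneq j 0%N.
    by rewrite (_ : [set _ | _] = setT)//; apply/seteqP.
  rewrite (_ : [set _ | _] = set0)//; apply/seteqP; split => // x /= h.
  by rewrite -h in j0.
have mk : measurable [set x | dyadic_index A k x = j./2].
  by apply: ih => n nk; apply: mA; exact: ltnW.
have mAk : measurable (if odd j then A k else ~` A k).
  by case: ifP => _; [|apply: measurableC]; exact: mA.
rewrite (_ : [set _ | _] = [set x | dyadic_index A k x = j./2] `&`
   if odd j then A k else ~` A k); first exact: measurableI.
apply/seteqP; split=> [x /= <-|x [/= h1 h2]].
  rewrite half_bit_double oddD odd_double addbF oddb; split=> //.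
  by case: asboolP.
rewrite h1 -[RHS]odd_double_half; congr (nat_of_bool _ + _)%N.
by case: (odd j) h2 => h2; apply/asboolP.
Qed.

End dyadic_index_measurable.

(** * Nested quantiles of a consistent family of masses *)

Section dyadic_quantile.
Context {R : realType} (p : nat -> nat -> R).
Hypothesis p_ge0 : forall k j, 0 <= p k j.
Hypothesis p00 : p 0 0 = 1.
Hypothesis p_split : forall k j, p k j = p k.+1 j.*2 + p k.+1 j.*2.+1.

(** [p k j] stands for the mass of cell [j] at level [k], and this is the distribution function of
    that level. Consistency of the levels makes it agree with the next one at even indices, so the
    quantile cells are nested. *)
Definition cumul k j : R := \sum_(i < j) p k i.

Lemma cumulS k j : cumul k j.+1 = cumul k j + p k j.
Proof. by rewrite /cumul big_ord_recr. Qed.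

Lemma cumul_double k j : cumul k.+1 j.*2 = cumul k j.
Proof.
elim: j => [|j ih]; first by rewrite /cumul !big_ord0.
by rewrite doubleS !cumulS ih -addrA -p_split.
Qed.

Lemma cumul_le k i j : (i <= j)%N -> cumul k i <= cumul k j.
Proof.
move=> /subnKC <-; elim: (j - i)%N => [|n ih]; first by rewrite addn0.
by rewrite addnS cumulS (le_trans ih)// lerDl.
Qed.

(** Makes the quantile total, with no exceptional points; on the support of the uniform law only the
    endpoint 1 is altered. *)
Definition unit_clamp (u : R) : R := if (0 <= u) && (u < 1) then u else 0.

Lemma unit_clamp_itv u : 0 <= unit_clamp u < 1.
Proof. by rewrite /unit_clamp; case: ifP => //; rewrite lexx ltr01. Qed.

(* The index of the cell [cumul k j, cumul k j.+1) containing u. *)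
Fixpoint quantile (k : nat) (u : R) : nat :=
  if k is k'.+1 then
    ((cumul k (quantile k' u).*2.+1 <= unit_clamp u)%R + (quantile k' u).*2)%N
  else 0%N.

Lemma quantile_half k u : (quantile k.+1 u)./2 = quantile k u.
Proof. by rewrite /= half_bit_double. Qed.

Lemma quantileP k u :
  cumul k (quantile k u) <= unit_clamp u < cumul k (quantile k u).+1.
Proof.
elim: k => [|k]; first by rewrite cumulS /cumul/= big_ord0 add0r p00 unit_clamp_itv.
rewrite -cumul_double -(cumul_double k (quantile k u).+1) doubleS => /andP[h1 h2] /=.
case: (leP (cumul k.+1 (quantile k u).*2.+1) (unit_clamp u)) => h /=;
  by rewrite ?add1n ?add0n; apply/andP.
Qed.

Lemma quantile_uniq k u j : cumul k j <= unit_clamp u < cumul k j.+1 ->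
  quantile k u = j.
Proof.
move=> /andP[h1 h2]; have /andP[h3 h4] := quantileP k u.
apply/eqP; rewrite eqn_leq; apply/andP; split; rewrite leqNgt; apply/negP => h.
  by have := lt_le_trans h2 (cumul_le k h) ; rewrite ltNge h3.
by have := lt_le_trans h4 (cumul_le k h) ; rewrite ltNge h1.
Qed.

(** A half-open interval that contains a point has positive length. As this holds for every [u] and
    not just almost every one, only cells that carry mass, hence nonempty ones, are ever
    selected. *)
Lemma quantile_p_gt0 k u : 0 < p k (quantile k u).
Proof.
by have /andP[h1 h2] := quantileP k u; move: (le_lt_trans h1 h2); rewrite cumulS ltrDl.
Qed.

Lemma quantile_measurable k j : measurable [set u | quantile k u = j].
Proof.
rewrite (_ : [set _ | _] = unit_clamp @^-1` `[cumul k j, cumul k j.+1[).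
  rewrite -[X in measurable X]setTI.
  suff : measurable_fun setT unit_clamp by apply => //; exact: measurable_itv.
  apply: measurable_fun_ifT => //.
  apply: measurable_and => //; first exact: measurable_fun_ler.
  exact: measurable_fun_ltr.
apply/seteqP; split=> u /=; rewrite in_itv/=; last exact: quantile_uniq.
by move=> <-; exact: quantileP.
Qed.

Lemma cumul_le1 k j : (j <= 2 ^ k)%N -> cumul k j <= 1.
Proof.
suff <- : cumul k (2 ^ k) = 1 by exact: cumul_le.
elim: k => [|k ih]; first by rewrite /cumul expn0 big_ord1 p00.
by rewrite expnS mul2n cumul_double.
Qed.

Lemma uniform_quantile k j : (j < 2 ^ k)%N ->
  uniform_prob (@ltr01 R) [set u | quantile k u = j] = (p k j)%:E.
Proof.
move=> jk; rewrite /uniform_prob integral_uniform_pdf.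
have h0 : 0 <= cumul k j by apply: sumr_ge0.
have h1 : cumul k j.+1 <= 1 by exact: cumul_le1.
(* The null point 1 is removed because [unit_clamp] sends it to 0; without it the event is exactly a
   half-open interval. *)
rewrite -(integral_setD1 (r := 1)); last 2 first.
- by apply: measurableD => //; apply: measurableI => //; exact: quantile_measurable.
- by apply/measurable_funTS/measurable_EFinP; exact: measurable_uniform_pdf.
rewrite (_ : _ `\` _ = `[cumul k j, cumul k j.+1[%classic); last first.
  apply/seteqP; split => u /=; rewrite !in_itv/=.
    move=> [[<- /andP[u0 u1]] /eqP u1'].
    have u_lt1 : u < 1 by rewrite lt_neqAle u1' u1.
    by have := quantileP k u; rewrite /unit_clamp u0 u_lt1.
  move=> /andP[ju uj]; have u0 := le_trans h0 ju; have u1 := lt_le_trans uj h1.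
  rewrite u0 (ltW u1); split; last by apply/eqP; rewrite lt_eqF.
  by split=> //; apply: quantile_uniq; rewrite /unit_clamp u0 u1/= ju.
rewrite (eq_integral (cst 1%E)); last first.
  move=> u; rewrite inE/= in_itv/= => /andP[ju uj].
  rewrite /uniform_pdf (le_trans h0 ju) (le_trans (ltW uj) h1)/=.
  by rewrite subr0 invr1.
rewrite integral_cst//= mul1e lebesgue_measure_itv/= lte_fin.
rewrite cumulS; case: ifPn => [_|]; first by rewrite -EFinB addrAC subrr add0r.
by rewrite -leNgt gerDl => pk; congr EFin; apply/esym/eqP; rewrite eq_le pk p_ge0.
Qed.

Lemma quantile_lt k u : (quantile k u < 2 ^ k)%N.
Proof.
rewrite ltnNge; apply/negP => h; have /andP[h1 _] := quantileP k u.
have := le_trans (cumul_le k h) h1.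
suff -> : cumul k (2 ^ k) = 1 by rewrite leNgt; have /andP[_ ->] := unit_clamp_itv u.
elim: k {h h1} => [|k ih]; first by rewrite /cumul expn0 big_ord1 p00.
by rewrite expnS mul2n cumul_double.
Qed.

End dyadic_quantile.

Section law_of_random_point.
Context {R : realType} {d0 d1} {Y : measurableType d0} {Z : measurableType d1}.

Lemma law_exists (Q : probability Y R) (X : Y -> Z) : measurable_fun setT X ->
  exists m : probability Z R, forall f : Z -> R, measurable_fun setT f ->
    (exists M, forall z, `|f z| <= M) -> \int[m]_z f z = \int[Q]_y f (X y).
Proof.
move=> mX; pose X' : {mfun Y >-> Z} := HB.pack X (isMeasurableFun.Build _ _ _ _ X mX).
exists (distribution Q X') => f mf [M hM].
rewrite /Rintegral integral_distribution//; first exact/measurable_EFinP.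
apply: (@bounded_integrable _ _ _ Q (f \o X) M) => [|y]; last exact: hM.
exact: measurableT_comp.
Qed.

Lemma Rintegral_finite_index (h : nat -> R) (Q : probability Y R) (n : nat)
    (N : Y -> nat) : (forall y, (N y < n)%N) ->
  (forall j, measurable [set y | N y = j]) ->
  \int[Q]_y h (N y) = \sum_(j < n) h j * fine (Q [set y | N y = j]).
Proof.
move=> Nn mN.
have E y : h (N y) = \sum_(j < n) h j * \1_[set y | N y = j] y.
  rewrite (bigD1 (Ordinal (Nn y)))//= indicE mem_set// mulr1 big1 ?addr0// => j jN.
  rewrite indicE memNset ?mulr0//= => jE; move/eqP : jN; apply.
  exact/val_inj.
under eq_Rintegral do rewrite E.
have hi (j : 'I_n) : Q.-integrable setT (EFin \o \1_[set y | N y = j]).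
  by apply: (@bounded_integrable _ _ _ Q _ 1) => // y; rewrite indicE; case: (_ \in _); rewrite ?normr1 ?normr0.
have [_ ->] := Rintegral_sum (index_enum 'I_n) (fun j => integrable_mulr (h j) (hi j)).
apply: eq_bigr => j _; rewrite RintegralZl//; congr (_ * _).
by rewrite /Rintegral integral_indic// setIT.
Qed.

End law_of_random_point.

(** * Limit laws and compactness *)

Section weak_compactness.
Context {R : realType} {d : nat} (A : nat -> set (torus R d)).
Local Notation T := (torus R d).
Local Notation P := (prob R d).
Local Notation idx := (dyadic_index A).
Hypothesis A_measurable : forall n, measurable (A n).
Hypothesis A_separating : forall e : R, 0 < e ->
  exists k, forall x y, (forall n, (n < k)%N -> A n x <-> A n y) -> tdist x y <= e.

Definition mesh_le (k : nat) (e : R) : Prop :=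
  forall x y : T, idx k x = idx k y -> tdist x y <= e.

Lemma mesh_small e : 0 < e -> exists k, mesh_le k e.
Proof.
move=> /A_separating[k hk]; exists k => x y xy; apply: hk => n nk.
exact: dyadic_index_eqP xy _ nk.
Qed.

Lemma idx_measurable k j : measurable [set x : T | idx k x = j].
Proof. by apply: dyadic_index_measurable. Qed.

Section limit_law.
Variable p : nat -> nat -> R.
Hypothesis p_ge0 : forall k j, 0 <= p k j.
Hypothesis p00 : p 0 0 = 1.
Hypothesis p_split : forall k j, p k j = p k.+1 j.*2 + p k.+1 j.*2.+1.
Hypothesis p_empty : forall k j, (forall x : T, idx k x <> j) -> p k j = 0.

(** For an empty cell this is the default point; by [p_empty] such a cell has mass zero, so the
    value has no influence. *)
Definition cell_point k j : T := get [set x : T | idx k x = j].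

Lemma cell_pointP k u : idx k (cell_point k (quantile p k u)) = quantile p k u.
Proof.
have := quantile_p_gt0 p00 p_split k u; set j := quantile p k u => pj.
apply: (@getPex _ [set x : T | idx k x = j]); apply: contrapT => h.
move: pj; rewrite p_empty ?ltxx// => x xj; apply: h; by exists x.
Qed.

Lemma idx_cell_point k n u : (k <= n)%N ->
  idx k (cell_point n (quantile p n u)) = quantile p k u.
Proof.
move=> kn; have := cell_pointP n u; set x := cell_point _ _.
elim: n {x} kn (x) => [|n ih] kn x; first by move: kn; rewrite leqn0 => /eqP ->.
move: kn; rewrite leq_eqVlt => /predU1P[-> //|kn] h; apply: ih => //.
by rewrite -dyadic_index_half h quantile_half.
Qed.

(** The cells are not closed, so their intersection may be empty. A cluster point of the chosen cell
    points serves instead: from level [k] on they all lie in the cell of level [k], hence in a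
    closed ball about its chosen point. *)
Lemma random_point_exists u : exists x : T, forall e k, mesh_le k e ->
  tdist (cell_point k (quantile p k u)) x <= e.
Proof.
pose s n := cell_point n (quantile p n u).
have [x [_ clx]] := @torus_compact R d (s @ \oo) _ filterT.
exists x => e k hk; set c := cell_point _ _.
have cl : closed [set z | tdist c z <= e].
  apply: (@closed_comp _ _ (tdist c) [set t | t <= e]); last exact: closed_le.
  by move=> z _; exact: tdist_continuous.
apply: cl => B Bx; apply: (clx [set z | tdist c z <= e] B) => //.
exists k => // n /= kn; apply: hk.
by rewrite !idx_cell_point.
Qed.

Definition random_point u : T := get [set x : T | forall e k, mesh_le k e ->
  tdist (cell_point k (quantile p k u)) x <= e].

Lemma random_pointP u e k : mesh_le k e ->
  tdist (cell_point k (quantile p k u)) (random_point u) <= e.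
Proof.
have := getPex (random_point_exists u); exact.
Qed.

(** A choice by [get] gives no measurability. It comes from the approximation: the preimage of an
    open set is the countable union of the events that the quantile at level [k] is [j], over those
    [k], [j] for which a ball about the cell point, of radius a mesh bound, stays inside the set. *)
Lemma random_point_measurable : measurable_fun setT random_point.
Proof.
apply: (measurability (@open T)) => // _ [B oB <-].
pose C k j := exists2 e, mesh_le k e & forall z, tdist (cell_point k j) z <= e -> B z.
rewrite setTI (_ : _ @^-1` _ = \bigcup_k \bigcup_(j in C k) [set u | quantile p k u = j]).
  apply: bigcup_measurable => k _; apply: bigcup_measurable => j _.
  exact: quantile_measurable.
apply/seteqP; split=> u /=; last first.
  by move=> [k _ [j Cj /= jE]]; move: Cj; rewrite -jE => -[e hk Be]; apply: Be; exact: random_pointP.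
move=> Bu; have [e e0 he] := open_tdist_ball oB Bu.
have e4 : 0 < e / 4 by rewrite divr_gt0.
have [k hk] := mesh_small e4.
exists k => //; exists (quantile p k u) => //; exists (e / 4) => // z hz; apply: he.
apply: le_lt_trans (tdist_triangle (cell_point k (quantile p k u)) _ _) _.
by rewrite tdistC; have := random_pointP u hk; lra.
Qed.

(** The law of the random point under the uniform variable. Replacing the random point by its cell
    point costs at most the mesh, and the expectation that remains is the sum exactly. *)
Lemma limit_law_exists : exists m : P, forall k e, mesh_le k e -> forall phi, lip1 phi ->
  `|pairing phi m - \sum_(j < 2 ^ k) phi (cell_point k j) * p k j| <= e.
Proof.
have [m hm] := law_exists (uniform_prob (@ltr01 R)) random_point_measurable.
exists m => k e hk phi lphi.
have cphi := lip1_continuous lphi; have mphi := continuous_torus_measurable cphi.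
have [M hM] := torus_bounded cphi.
rewrite /pairing hm//; last by exists M.
have -> : \sum_(j < 2 ^ k) phi (cell_point k j) * p k j =
    \int[uniform_prob (@ltr01 R)]_u phi (cell_point k (quantile p k u)).
  rewrite (Rintegral_finite_index (fun j => phi (cell_point k j)) _ (n := 2 ^ k)).
  - by apply: eq_bigr => j _; congr (_ * _);
      rewrite -[LHS]/(fine (p k j)%:E) -(uniform_quantile p_ge0 p00 p_split (ltn_ord j)).
  - by move=> u; exact: quantile_lt.
  - by move=> j; exact: quantile_measurable.
have mX : measurable_fun setT (fun u => phi (random_point u)).
  by apply: measurableT_comp => //; exact: random_point_measurable.
have mq : measurable_fun setT (fun u => phi (cell_point k (quantile p k u))).
  move=> _ B mB; rewrite setTI.
  rewrite (_ : _ @^-1` _ = \bigcup_(j in [set j | B (phi (cell_point k j))])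
    [set u | quantile p k u = j]).
    by apply: bigcup_measurable => j _; exact: quantile_measurable.
  by apply/seteqP; split=> [u /= Bu|u [j /= Bj jE]]; [exists (quantile p k u)|rewrite jE].
rewrite -RintegralB//; first last.
- by apply: (@bounded_integrable _ _ _ _ _ M) => // u; exact: hM.
- by apply: (@bounded_integrable _ _ _ _ _ M) => // u; exact: hM.
apply: Rintegral_norm_le => [|u]; first exact: measurable_funB.
by apply: le_trans (lphi _ _) _; rewrite tdistC; exact: random_pointP.
Qed.

End limit_law.

Lemma pairing_cells (m : P) k e phi : mesh_le k e -> lip1 phi ->
  `|pairing phi m - \sum_(j < 2 ^ k) phi (cell_point k j) *
     fine (m [set x | idx k x = j])| <= e.
Proof.
move=> hk lphi.
have cphi := lip1_continuous lphi; have mphi := continuous_torus_measurable cphi.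
have [M hM] := torus_bounded cphi.
rewrite -(Rintegral_finite_index (fun j => phi (cell_point k j)) _ (n := 2 ^ k));
  [|by move=> x; exact: dyadic_index_lt|by move=> j; exact: idx_measurable].
have mq : measurable_fun setT (fun x => phi (cell_point k (idx k x))).
  move=> _ B mB; rewrite setTI.
  rewrite (_ : _ @^-1` _ = \bigcup_(j in [set j | B (phi (cell_point k j))])
    [set x | idx k x = j]).
    by apply: bigcup_measurable => j _; exact: idx_measurable.
  by apply/seteqP; split=> [u /= Bu|u [j /= Bj jE]]; [exists (idx k u)|rewrite jE].
rewrite -RintegralB//; first last.
- by apply: bounded_integrable mq _ => u; exact: hM.
- by apply: bounded_integrable mphi _ => u; exact: hM.
apply: Rintegral_norm_le => [|x]; first exact: measurable_funB.
apply: le_trans (lphi _ _) _; apply: hk.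
by rewrite (@getPex _ [set y : T | idx k y = idx k x])//; exists x.
Qed.

Lemma ultrafilter_limit (F : set_system P) (g : P -> R) (M : R) : UltraFilter F ->
  (forall m, `|g m| <= M) -> exists l : R, g @ F --> l.
Proof.
move=> UF gM; have PF : ProperFilter F by exact: ultra_proper.
have GM : (g @ F) `[- M, M]%classic.
  apply: (@filterS _ F _ setT) filterT => m _ /=; rewrite in_itv/=.
  by have := gM m; rewrite ler_norml.
have [l [_ cl]] := @segment_compact R (- M) M (g @ F) _ GM.
exists l => B Bl; have [//|h] := in_ultra_setVsetC (g @^-1` B) UF.
have hC : (g @ F) (~` B) by [].
by have [y [/= nBy By]] := cl _ _ hC Bl.
Qed.

Let mass (k j : nat) (m : P) : R := fine (m [set x : T | idx k x = j]).

Let mass_fin (m : P) k j : m [set x : T | idx k x = j] = (mass k j m)%:E.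
Proof. by rewrite /mass fineK// fin_num_measure//; exact: idx_measurable. Qed.

Let mass_ge0 k j m : 0 <= mass k j m.
Proof. exact: fine_ge0. Qed.

Let mass_le1 k j m : mass k j m <= 1.
Proof.
rewrite -lee_fin -mass_fin; apply: probability_le1; exact: idx_measurable.
Qed.

Let mass00 m : mass 0 0 m = 1.
Proof.
rewrite /mass (_ : [set _ | _] = setT) ?probability_setT//.
by apply/seteqP.
Qed.

Let mass_split k j m : mass k j m = mass k.+1 j.*2 m + mass k.+1 j.*2.+1 m.
Proof.
apply: EFin_inj; rewrite EFinD -!mass_fin -measureU; first last.
- by rewrite -subset0 => x [/= -> /eqP]; rewrite eqn_leq ltnn andbF.
- exact: idx_measurable.
- exact: idx_measurable.
congr (m _); apply/seteqP; split=> x.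
  move=> /= <-; case: asboolP => _; rewrite ?add1n ?add0n; [by right|by left].
by move=> []; rewrite /mkset => h; rewrite -(dyadic_index_half A k x) h ?doubleK//= uphalf_double.
Qed.

Let mass_empty k j m : (forall x : T, idx k x <> j) -> mass k j m = 0.
Proof.
move=> h; rewrite /mass (_ : [set _ | _] = set0) ?measure0//.
by rewrite -subset0 => x /h.
Qed.

(** Along an ultrafilter every cell mass converges, and positivity and consistency pass to the
    limits. The limit masses need not be the masses of the cells under the limit law, since mass may
    drift to a cell boundary; the comparison therefore goes through the sums over cells. *)
Lemma prob_compact : compact [set: P].
Proof.
rewrite compact_ultra => F UF _.
have PF : ProperFilter F by exact: ultra_proper.
have lim_ex k j : exists l : R, mass k j @ F --> l.
  by apply: (@ultrafilter_limit F _ 1) => // m; rewrite ger0_norm.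
pose p k j := xget 0 [set l : R | mass k j @ F --> l].
have pP k j : mass k j @ F --> p k j.
  have [l hl] := lim_ex k j.
  exact: (@xgetPex _ _ [set l : R | mass k j @ F --> l] (lim_ex k j)).
have p_eq k j (g : P -> R) l : g @ F --> l -> mass k j = g -> p k j = l.
  by move=> gl e; apply: (cvg_unique _ (pP k j)) => //; rewrite e.
have p_ge0 k j : 0 <= p k j.
  apply: (@closed_cvg _ _ F _ (mass k j) (fun x : R => 0 <= x) (@closed_ge R 0) _ _ (pP k j)).
  by apply: filterS filterT => m _; exact: mass_ge0.
have p00 : p 0%N 0%N = 1.
  apply: (@p_eq 0%N 0%N (cst 1)); first exact: cvg_cst.
  by apply/funext => m; exact: mass00.
have p_split k j : p k j = p k.+1 j.*2 + p k.+1 j.*2.+1.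
  apply: (@p_eq k j (mass k.+1 j.*2 \+ mass k.+1 j.*2.+1)).
    exact: cvgD.
  by apply/funext => m; exact: mass_split.
have p_empty k j : (forall x : T, idx k x <> j) -> p k j = 0.
  move=> h; apply: (@p_eq k j (cst 0)); first exact: cvg_cst.
  by apply/funext => m; exact: mass_empty.
have [m hm] := limit_law_exists p_ge0 p00 p_split p_empty.
exists m; split => //; apply/cvg_ballP => e e0.
have e8 : 0 < e / 8 by rewrite divr_gt0.
have [k hk] := mesh_small e8.
(* Number of cells times a bound on the normalised Lipschitz functions: with each mass known up to
   [e / 8 / D], the sums differ by at most [e / 8]. *)
pose D : R := (2 ^ k)%:R * (d%:R + 1).
have D0 : 0 < D by rewrite mulr_gt0// ?ltr0n ?expn_gt0// ltr_wpDl.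
have : \forall m' \near F, forall j : 'I_(2 ^ k), `|p k j - mass k j m'| <= e / 8 / D.
  apply: filter_forall => j.
  by apply: (@cvgrPdist_le _ _ _ F _ _ _).1 => //; rewrite divr_gt0.
apply: filterS => m' hm'; rewrite /ball/=.
rewrite /d1_ball; apply: (@le_lt_trans _ _ (e / 2)%:E); last by rewrite lte_fin; lra.
apply: ub_ereal_sup => _ [phi lphi <-]; rewrite lee_fin.
have cphi := lip1_continuous lphi; have [M hM] := torus_bounded cphi.
have mphi := continuous_torus_measurable cphi.
(* Subtracting a constant changes no difference of pairings and bounds all 1-Lipschitz functions by
   the diameter, uniformly. *)
pose psi x := phi x - phi point.
have lpsi : lip1 psi by move=> x y; rewrite /psi opprB addrA subrK; exact: lphi.
have psid x : `|psi x| <= d%:R by rewrite (le_trans (lphi _ _))// tdist_le_dim.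
have psiE (q : P) : pairing psi q = pairing phi q - phi point.
  rewrite /pairing RintegralB//; last exact: finite_measure_integrable_cst.
    by rewrite Rintegral_cst_prob.
  exact: bounded_integrable mphi hM.
rewrite /pairing_sub (_ : _ - _ = pairing psi m - pairing psi m'); last by rewrite !psiE; ring.
have h1 := hm k _ hk _ lpsi; have h2 := pairing_cells m' hk lpsi.
have h3 : `|\sum_(j < 2 ^ k) psi (cell_point k j) * p k j -
           \sum_(j < 2 ^ k) psi (cell_point k j) * mass k j m'| <= e / 8.
  rewrite -sumrB (le_trans (ler_norm_sum _ _ _))//.
  apply: (@le_trans _ _ (\sum_(j < 2 ^ k) (d%:R + 1) * (e / 8 / D))).
    apply: ler_sum => j _; rewrite -mulrBr normrM ler_pM//.
    by rewrite (le_trans (psid _))// lerDl.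
  rewrite sumr_const card_ord -[leLHS]mulr_natl [leLHS]mulrA -/D.
  by rewrite [leLHS]mulrC divfK// gt_eqF.
move: h1 h2 h3; rewrite !ler_norml /mass.
by move=> /andP[? ?] /andP[? ?] /andP[? ?]; lra.
Qed.

End weak_compactness.

(** * A countable separating family of smooth functions *)

Section bounded_convergence.
Context {d0} {Y : measurableType d0} {R : realType} (P : probability Y R).

Lemma bounded_convergence (f : nat -> Y -> R) (g : Y -> R) (M : R) :
  (forall n, measurable_fun setT (f n)) -> measurable_fun setT g ->
  (forall n y, `|f n y| <= M) -> (forall y, f ^~ y @ \oo --> g y) ->
  (\int[P]_y f n y) @[n --> \oo] --> \int[P]_y g y.
Proof.
move=> mf mg fM fg.
have gM y : `|g y| <= M.
  apply: (@closed_cvg _ _ \oo _ (f ^~ y) (fun t : R => `|t| <= M)) (fg y).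
    apply: (@closed_comp _ _ (fun t : R => `|t|) [set t | t <= M]); last exact: closed_le.
    by move=> t _; exact: norm_continuous.
  by apply: nearW => n; exact: fM.
have gfin : (\int[P]_x (g x)%:E)%E \is a fin_num.
  by apply: integrable_fin_num => //; exact: bounded_integrable mg gM.
have h3 : (\int[P]_y (f n y)%:E)%E @[n --> \oo] --> (\int[P]_y (g y)%:E)%E.
  apply: (@dominated_cvg _ _ _ P setT measurableT (fun n => EFin \o f n)
    (EFin \o g) (EFin \o cst M)) => //.
  - by move=> n; exact/measurable_EFinP.
  - by move=> y _; apply: cvg_EFin; [exact: nearW|exact: fg].
  - exact: finite_measure_integrable_cst.
  - by move=> n y _; rewrite /= lee_fin; exact: fM.
rewrite -(fineK gfin) in h3.
exact: (fine_cvg h3).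
Qed.

End bounded_convergence.

(** * Polynomials converging to a step *)

Section polynomial_steps.
Context {R : realType}.
Implicit Types (w x h : R).

Lemma bernoulli_le h n : -1 <= h -> 1 + n%:R * h <= (1 + h) ^+ n.
Proof.
move=> h1; elim: n => [|n ih]; first by rewrite mul0r addr0.
rewrite exprS -natr1; have := sqr_ge0 h; rewrite expr2 => hh.
have n0 : 0 <= n%:R :> R by [].
have : (1 + h) * (1 + n%:R * h) <= (1 + h) * (1 + h) ^+ n by apply: ler_wpM2l => //; lra.
apply: le_trans; nra.
Qed.

Lemma cvg_natM_expr x : 0 <= x < 1 -> (n%:R * x ^+ n) @[n --> \oo] --> (0 : R).
Proof.
move=> /andP[x0 x1].
have [->|xn0] := eqVneq x 0.
  apply: cvg_near_cst; exists 1%N => // -[|n] //= _.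
  by rewrite exprS mul0r mulr0.
(* One factor [y ^+ n] absorbs [n], by the Bernoulli inequality applied to the inverse of [y]; the
   other tends to zero. *)
pose y := Num.sqrt x.
have y0 : 0 < y by rewrite sqrtr_gt0 lt_neqAle eq_sym xn0.
have y1 : y < 1 by rewrite -sqrtr1 ltr_sqrt.
pose h := y^-1 - 1.
have h0 : 0 < h by rewrite subr_gt0 invf_gt1.
have yn n : n%:R * y ^+ n <= h^-1.
  have := @bernoulli_le h n; rewrite (le_trans _ (ltW h0))// => /(_ isT).
  rewrite /h subrKC exprVn -/h => hn.
  rewrite -(ler_pM2l h0) divff ?gt_eqF// mulrCA mulrA.
  have yn0 : 0 < y ^+ n by rewrite exprn_gt0.
  rewrite -ler_pdivlMr// mul1r mulrC (le_trans _ hn)//.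
  by rewrite [h * _]mulrC lerDr.
apply: (@squeeze_cvgr _ _ _ _ (cst 0) (fun n => h^-1 * y ^+ n)).
- apply: nearW => n; rewrite mulr_ge0 ?exprn_ge0//= -(sqr_sqrtr x0) -/y -exprM mulnC exprM.
  by rewrite expr2 mulrA ler_wpM2r// exprn_ge0// ltW.
- exact: cvg_cst.
- by apply: (@cvg_geometric _ h^-1 y); rewrite gtr0_norm.
Qed.

(* These polynomials in w converge on [0, 1] to the indicator of [0, 1/K). *)
Definition poly_step (K n : nat) (w : R) : R := (1 - w ^+ n.+1) ^+ (n.+1 * K ^ n.+1).

Lemma poly_step01 K n w : 0 <= w <= 1 -> 0 <= poly_step K n w <= 1.
Proof.
move=> /andP[w0 w1].
have h : 0 <= w ^+ n.+1 <= 1 by rewrite exprn_ge0//= exprn_ile1.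
rewrite /poly_step exprn_ge0 ?exprn_ile1 ?subr_ge0//; first last.
- by case/andP: h.
- by case/andP: h => h1 h2; rewrite lerBlDr lerDl.
- by case/andP: h.
Qed.

(** A variant of the Brosowski-Deutsch polynomials. Below the threshold the Bernoulli inequality
    bounds them below by 1 - n (K w)^n; above it, multiplication by (1 + v)^m, which is at least n,
    gives at most 1, as (1 - v)(1 + v) <= 1. The factor [n.+1] in the exponent forces the limit 0 at
    the threshold itself. *)
Lemma poly_step_cvg K w : (0 < K)%N -> 0 <= w <= 1 ->
  poly_step K n w @[n --> \oo] --> (if w < K%:R^-1 then 1 else 0 : R).
Proof.
move=> K0 w01; have /andP[w0 w1] := w01.
have K0' : 0 < K%:R :> R by rewrite ltr0n.
have h n : 0 <= w ^+ n <= 1 by rewrite exprn_ge0//= exprn_ile1.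
case: ifPn => [wK|].
  have Kw : 0 <= K%:R * w < 1 by rewrite mulr_ge0//= -ltr_pdivlMl// mulr1.
  have c0 := cvg_natM_expr Kw.
  have c1 : (1 - n.+1%:R * (K%:R * w) ^+ n.+1) @[n --> \oo] --> (1 : R).
    rewrite -[X in _ --> X]subr0; apply: cvgB; first exact: cvg_cst.
    by move: c0; rewrite -cvg_shiftS.
  apply: (squeeze_cvgr _ c1 (@cvg_cst _ (1 : R) _ _ _)); apply: nearW => n.
  have /andP[_ ->] := poly_step01 K n w01; rewrite andbT /poly_step.
  have := @bernoulli_le (- w ^+ n.+1) (n.+1 * K ^ n.+1).
  rewrite lerN2; case/andP: (h n.+1) => _ -> /(_ isT); apply: le_trans.
  by rewrite mulrN natrM natrX exprMn mulrA.
rewrite -leNgt => wK.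
have Kw : 1 <= K%:R * w by rewrite -ler_pdivrMl// mulr1.
apply: (@squeeze_cvgr _ _ _ _ (cst 0) harmonic) => //; last first.
- exact: cvg_harmonic.
- exact: cvg_cst.
apply: nearW => n; have /andP[-> _] := poly_step01 K n w01; rewrite /= /poly_step.
set m := (n.+1 * _)%N; set v := w ^+ n.+1.
have /andP[v0 v1] := h n.+1.
have b : n.+1%:R <= (1 + v) ^+ m.
  apply: le_trans (@bernoulli_le v m _); last by rewrite (le_trans _ v0)// lerN10.
  rewrite /m natrM natrX -mulrA -exprMn.
  apply: (@le_trans _ _ (n.+1%:R * (K%:R * w) ^+ n.+1)); last by rewrite lerDr.
  by rewrite ler_peMr// exprn_ege1.
have v1' : 0 <= 1 - v by rewrite subr_ge0.
rewrite -[leRHS]mul1r ler_pdivlMr ?ltr0n//.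
apply: (@le_trans _ _ ((1 - v) ^+ m * (1 + v) ^+ m)).
  by rewrite ler_wpM2l// exprn_ge0.
rewrite -exprMn exprn_ile1//.
  by rewrite mulr_ge0// addr_ge0.
by rewrite -subr_sqr expr1n lerBlDr lerDl sqr_ge0.
Qed.

End polynomial_steps.

(** * Smooth bumps and a countable base of the torus *)

Section torus_bumps.
Context {R : realType} {d : nat}.
Local Notation V := 'rV[R]_d.
Local Notation T := (torus R d).
Local Notation P := (prob R d).
Implicit Types (a b y : V) (x z : T).

(* The average of sin^2 (pi (a_i - y_i)) over d.+1 rather than d, so that the
   values lie in [0, 1] also for d = 0. *)
Definition bump y a : R := d.+1%:R^-1 *
  \sum_(i < d) (1 / 2 + (- (1 / 2)) * cos ((pi *+ 2) * a ord0 i + (- ((pi *+ 2) * y ord0 i)))).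

Lemma bumpE y a : bump y a = d.+1%:R^-1 * \sum_(i < d) sin (pi * (a ord0 i - y ord0 i)) ^+ 2.
Proof.
congr (_ * _); apply: eq_bigr => i _.
rewrite (_ : _ + - _ = (pi * (a ord0 i - y ord0 i)) *+ 2).
  by rewrite cos_mulr2n sin2cos2 !mulr2n; field.
by rewrite !mulr2n; ring.
Qed.

Lemma bump_sym y a : bump y a = bump a y.
Proof.
rewrite !bumpE; congr (_ * _); apply: eq_bigr => i _.
by rewrite -opprB mulrN sinN sqrrN.
Qed.

Lemma sin_pi_int2 (t n : R) : n \is a Num.int -> sin (pi * (t + n)) ^+ 2 = sin (pi * t) ^+ 2.
Proof.
suff nat_case (u : R) (k : nat) : sin (pi * (u + k%:R)) ^+ 2 = sin (pi * u) ^+ 2.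
  move=> /intrP[[k|k] ->]; first exact: nat_case.
  by rewrite -(nat_case (t + _) k.+1) NegzE mulrNz subrK.
elim: k => [|k ih]; first by rewrite addr0.
by rewrite -ih -natr1 addrA mulrDr mulr1 sinDpi sqrrN.
Qed.

Lemma bump_periodic y a b : \pi_T a = \pi_T b -> bump y a = bump y b.
Proof.
move=> /torus_piP ab; rewrite !bumpE; congr (_ * _); apply: eq_bigr => i _.
rewrite -(sin_pi_int2 (b ord0 i - y ord0 i) (ab i)); congr (sin (_ * _) ^+ _); ring.
Qed.

Lemma bump01 y a : 0 <= bump y a <= 1.
Proof.
rewrite bumpE mulr_ge0 ?sumr_ge0//=; last by move=> i _; exact: sqr_ge0.
rewrite -(ler_pM2l (ltr0Sn _ d)) mulrA divff ?pnatr_eq0// mul1r mulr1.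
apply: (@le_trans _ _ (\sum_(i < d) (1 : R))).
  by apply: ler_sum => i _; rewrite -real_normK ?num_real// exprn_ile1// sin_max.
by rewrite sumr_const card_ord ler_nat.
Qed.

Lemma bump_eq0 y a : bump y a = 0 -> \pi_T a = \pi_T y :> T.
Proof.
move=> /eqP; rewrite bumpE mulf_eq0 invr_eq0 pnatr_eq0/=.
rewrite psumr_eq0; last by move=> i _; exact: sqr_ge0.
move=> /allP h; apply/torus_piP => i.
have := h i (mem_index_enum i); rewrite /= sqrf_eq0 => /eqP s0.
set t := a ord0 i - y ord0 i in s0 *.
have /andP[f1 f2] := Num.Theory.floor_itv t.
suff -> : t = (Num.floor t)%:~R by rewrite intr_int.
have s1 : sin (pi * (t - (Num.floor t)%:~R)) ^+ 2 = 0.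
  by rewrite sin_pi_int2 ?rpredN ?intr_int// s0 expr0n.
apply/eqP; rewrite -subr_eq0 eq_le subr_ge0 f1 andbT leNgt; apply/negP => t0.
have : 0 < sin (pi * (t - (Num.floor t)%:~R)).
  apply: sin_gt0_pi; rewrite mulr_gt0 ?pi_gt0//= -[ltRHS]mulr1 ltr_pM2l ?pi_gt0//.
  by rewrite ltrBlDl -intrD1.
by move=> /lt0r_neq0; move/eqP: s1; rewrite sqrf_eq0 => ->.
Qed.

Lemma bump_bnd k : exists M, forall y, bnd k M (bump y).
Proof.
pose c := `|(1 / 2 : R)| + `|- (1 / 2) : R| * (1 + `|(pi *+ 2 : R)|) ^+ k.
exists (`|d.+1%:R^-1 : R| * \sum_(i < d) c) => y.
apply: bndZ; apply: bnd_sum => i; apply: bndD; first exact: bnd_cst.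
exact: bnd_cos.
Qed.

Definition tbump y x : R := bump y (repr x).

Lemma tbumpE y a : tbump y (\pi_T a) = bump y a.
Proof. by apply: bump_periodic; rewrite reprK. Qed.

Lemma tbump01 y x : 0 <= tbump y x <= 1.
Proof. exact: bump01. Qed.

Lemma tbump_continuous y : continuous (tbump y).
Proof.
apply/continuous_torusP; have [M /(_ y) /bnd_continuous] := bump_bnd 1.
by under [X in _ -> continuous X]eq_fun do rewrite tbumpE.
Qed.

(** Rational centres make the family countable, and thresholds of the form of an inverse integer are
    those at which [poly_step] jumps. *)
Definition cell (c : 'rV[rat]_d * nat) : set T :=
  [set x | tbump (map_mx ratr c.1) x < c.2.+1%:R^-1].

Lemma cell_open c : open (cell c).
Proof.
apply: (@open_comp _ _ (tbump (map_mx ratr c.1)) [set t | t < c.2.+1%:R^-1]).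
  by move=> x _; exact: tbump_continuous.
exact: open_lt.
Qed.

Lemma bump_lip : exists M, forall y z a : V,
  `|bump y a - bump z a| <= M * \sum_i `|y ord0 i - z ord0 i|.
Proof.
have [M hM] := bump_bnd 1; exists M => y z a.
by rewrite ![bump _ a]bump_sym; exact: bnd_lip (hM a) _ _.
Qed.

Lemma rat_approx (y : V) (e : R) : 0 < e ->
  exists q : 'rV[rat]_d, forall i, `|(map_mx ratr q : V) ord0 i - y ord0 i| <= e.
Proof.
move=> e0.
have h i : exists q : rat, `|ratr q - y ord0 i| <= e.
  have : y ord0 i < y ord0 i + e by rewrite ltrDl.
  move=> /rat_in_itvoo[q]; rewrite in_itv/= => /andP[q1 q2]; exists q.
  by rewrite ger0_norm ?subr_ge0 ?lerBlDl ltW.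
have [q hq] := choice h.
by exists (\row_i q i) => i; rewrite !mxE.
Qed.

Lemma cell_base (O : set T) x : open O -> O x ->
  exists c, cell c x /\ cell c `<=` O.
Proof.
move=> oO Ox; pose y := repr x.
(* The bump replaces the distance: it vanishes only at its centre, so its minimum over the compact
   complement of [O] is positive. *)
have [e e0 he] : exists2 e : R, 0 < e & forall z, tbump y z < e -> O z.
  have [[z0 nz0]|] := pselect ((~` O) !=set0); last first.
    by move=> h; exists 1 => // z _; apply: contrapT => nz; apply: h; exists z.
  have cO : compact (~` O).
    apply: (subclosed_compact _ torus_compact) => //.
    by rewrite closedC.
  have [|c /set_mem nc hc] := compact_EVT_min (ex_intro _ z0 nz0) cO (f := tbump y).
    by apply: continuous_subspaceT; exact: tbump_continuous.
  exists (tbump y c).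
    rewrite lt_neqAle eq_sym; have /andP[-> _] := tbump01 y c; rewrite andbT.
    apply/eqP => /bump_eq0; rewrite !reprK => cx; apply: nc; rewrite cx //.
  move=> z zc; apply: contrapT => nz; have := hc z (mem_set nz).
  by rewrite leNgt zc.
have [M hM] := bump_lip.
(* The radius is 1/(k+1), and the rational centre is so close to [y] that the bump changes by at
   most half of it. Then [x] is in the cell, and the bump about [y] is below 2/(k+1) <= e on the
   cell. *)
pose k := Num.truncn (2 / e).
have k0 : 0 < k.+1%:R :> R by rewrite ltr0n.
have ke : 2 / k.+1%:R <= e.
  rewrite ler_pdivrMr// mulrC -ler_pdivrMr// ltW//.
  exact: truncnS_gt.
pose L := (`|M| + 1) * (d%:R + 1).
have L0 : 0 < L by rewrite mulr_gt0// ltr_wpDl.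
have eta0 : 0 < (2 * k.+1%:R)^-1 / L by rewrite divr_gt0// invr_gt0 mulr_gt0.
have [q hq] := rat_approx y eta0.
have close z : `|tbump (map_mx ratr q) z - tbump y z| <= (2 * k.+1%:R)^-1.
  apply: le_trans (hM _ _ _) _.
  apply: (@le_trans _ _ ((`|M| + 1) * (d%:R * ((2 * k.+1%:R)^-1 / L)))).
    apply: (@le_trans _ _ ((`|M| + 1) * \sum_i `|(map_mx ratr q : V) ord0 i - y ord0 i|)).
      by rewrite ler_wpM2r ?sumr_ge0// (le_trans (ler_norm _))// lerDl.
    rewrite ler_wpM2l ?addr_ge0//.
    apply: le_trans (ler_sum _ (fun i _ => hq i)) _.
    by rewrite sumr_const card_ord -[leLHS]mulr_natl.
  rewrite [leLHS](_ : _ = (2 * k.+1%:R)^-1 * ((`|M| + 1) * d%:R / L)); last by ring.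
  rewrite ler_piMr ?invr_ge0 ?mulr_ge0//.
  by rewrite ler_pdivrMr// mul1r ler_wpM2l ?addr_ge0// lerDl.
have half : (2 * k.+1%:R)^-1 < k.+1%:R^-1 :> R.
  by rewrite invfM mulrC ltr_pdivrMr// ltr_pMr ?invr_gt0// ltr1n.
exists (q, k); split.
  have := close x; rewrite /cell/= {2}/tbump -/y.
  have -> : bump y y = 0.
    by rewrite bumpE big1 ?mulr0// => i _; rewrite subrr mulr0 sin0 expr0n.
  by rewrite subr0 => /(le_trans (ler_norm _)) /le_lt_trans; apply.
move=> z; rewrite /cell/= => hz; apply: he.
have e1 : tbump y z <= tbump (map_mx ratr q) z + (2 * k.+1%:R)^-1.
  by have := close z; rewrite ler_norml => /andP[+ _]; rewrite lerNl opprB lerBlDl.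
apply: (le_lt_trans e1); apply: (lt_le_trans (ltrD hz half)).
by apply: le_trans ke; rewrite mulr_natl mulr2n.
Qed.

End torus_bumps.

(** * Separation of measures by products of steps *)

Section separating_family.
Context {R : realType} {d : nat}.
Local Notation V := 'rV[R]_d.
Local Notation T := (torus R d).
Local Notation P := (prob R d).
Local Notation I := ('rV[rat]_d * nat)%type.
Implicit Types (a b : V) (x z : T) (c : I) (s : seq I).

Definition cells (n : nat) : set T := if unpickle n is Some c then cell c else set0.

Lemma cells_measurable n : measurable (cells n).
Proof.
rewrite /cells; case: unpickle => [c|//].
by apply: sub_sigma_algebra; exact: cell_open.
Qed.

(** Each point has a cell inside the ball of radius [e / 2] about it. Compactness makes one finite
    stock of cells serve all points. *)
Lemma cells_separating (e : R) : 0 < e -> exists k, forall x z : T,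
  (forall n, (n < k)%N -> cells n x <-> cells n z) -> tdist x z <= e.
Proof.
move=> e0; have e2 : 0 < e / 2 by rewrite divr_gt0.
have /compact_near_coveringP nc := @torus_compact R d.
pose Q k (x : T) := forall z, (forall n, (n < k)%N -> cells n x <-> cells n z) -> tdist x z <= e.
have : \forall k \near \oo, [set: T] `<=` Q k.
  apply: nc => x _.
  have oB : open [set z | tdist x z < e / 2].
    apply: (@open_comp _ _ (tdist x) [set t | t < e / 2]); last exact: open_lt.
    by move=> z _; exact: tdist_continuous.
  have Bx : [set z | tdist x z < e / 2] x by rewrite /= tdistxx.
  have [c [cx cB]] := cell_base oB Bx.
  exists (cell c, [set k | (pickle c < k)%N]).
    split; first by apply: open_nbhs_nbhs; split => //; exact: cell_open.
    by exists (pickle c).+1.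
  move=> [y k] [/= cy ck] z hz.
  have cE : cells (pickle c) = cell c by rewrite /cells pickleK.
  have cz : cell c z by rewrite -cE -(hz _ ck) cE.
  have := tdist_triangle x y z; have := cB _ cy; have := cB _ cz.
  by rewrite /= (tdistC y x); lra.
move=> [k _ hk]; exists k => x z; exact: (hk k (leqnn k) x Logic.I).
Qed.

Definition step_product s (n : nat) a : R :=
  \prod_(c <- s) poly_step c.2.+1 n (bump (map_mx ratr c.1) a).

Definition smooth_bounded (g : V -> R) := forall k, exists M, bnd k M g.

Lemma smooth_bounded_cst (r : R) : smooth_bounded (cst r).
Proof. by move=> k; exists `|r|; exact: bnd_cst. Qed.

Lemma smooth_boundedM f g : smooth_bounded f -> smooth_bounded g ->
  smooth_bounded (fun a => f a * g a).
Proof.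
by move=> hf hg k; have [M hM] := hf k; have [N hN] := hg k; eexists; exact: bndM hM hN.
Qed.

Lemma smooth_boundedX f n : smooth_bounded f -> smooth_bounded (fun a => f a ^+ n).
Proof.
move=> hf; elim: n => [|n ih]; first exact: smooth_bounded_cst.
by rewrite (_ : (fun _ => _) = fun a => f a * f a ^+ n);
  [exact: smooth_boundedM|apply/funext => a; rewrite exprS].
Qed.

Lemma smooth_bounded_step_product s n : smooth_bounded (step_product s n).
Proof.
elim: s => [|c s ih].
  rewrite (_ : step_product _ _ = cst 1); first exact: smooth_bounded_cst.
  by apply/funext => a; rewrite /step_product big_nil.
rewrite (_ : step_product _ _ = fun a =>
    poly_step c.2.+1 n (bump (map_mx ratr c.1) a) * step_product s n a).
  apply: smooth_boundedM => //; apply: smooth_boundedX => k.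
  have hb : smooth_bounded (bump (map_mx ratr c.1 : V)).
    by move=> l; have [M hM] := @bump_bnd R d l; exists M.
  have [M hM] := smooth_boundedX n.+1 hb k.
  exists (`|1| + `|-1 : R| * M).
  rewrite (_ : (fun _ => _) = fun a => cst (1 : R) a + (-1) * bump (map_mx ratr c.1) a ^+ n.+1).
    by apply: bndD; [exact: bnd_cst|exact: bndZ].
  by apply/funext => a; rewrite /= mulN1r.
by apply/funext => a; rewrite /step_product big_cons.
Qed.

Definition step_bound s n : R := `|sval (cid (smooth_bounded_step_product s n 4%N))| + 1.

Lemma step_bound_gt0 s n : 0 < step_bound s n.
Proof. by rewrite ltr_wpDl. Qed.

(* The factor makes all derivatives up to order four bounded by one. *)
Definition separating (N : nat) (x : T) : R :=
  if unpickle N is Some (s, n) then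
    (step_bound s n)^-1 * step_product s n (repr x) else 0.

Lemma step_product_periodic s n a b : \pi_T a = \pi_T b ->
  step_product s n a = step_product s n b.
Proof. by move=> ab; apply: eq_bigr => c _; rewrite (bump_periodic _ ab). Qed.

Lemma separating_bnd N : bnd 4%N 1 (tlift (separating N)).
Proof.
rewrite /tlift /separating; case: unpickle => [[s n]|]; last first.
  by apply: bnd_le (bnd_cst 4%N 0); rewrite normr0.
rewrite (_ : (fun _ => _) = fun a => (step_bound s n)^-1 * step_product s n a); last first.
  by apply/funext => a; congr (_ * _); apply: step_product_periodic; rewrite reprK.
have := svalP (cid (smooth_bounded_step_product s n 4%N)) => h.
apply: bnd_le (bndZ _ h).
have B0 := step_bound_gt0 s n.
rewrite gtr0_norm ?invr_gt0// [leLHS]mulrC ler_pdivrMr//.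
by rewrite mul1r /step_bound (le_trans (ler_norm _))// lerDl.
Qed.

Definition cell_meet s : set T := [set x | forall c, c \in s -> cell c x].

Lemma cell_meet_cons c s : cell_meet (c :: s) = cell c `&` cell_meet s.
Proof.
apply/seteqP; split=> x.
  by move=> h; split; [apply: h; rewrite mem_head|move=> c' c's; apply: h; rewrite inE c's orbT].
by move=> [h1 h2] c'; rewrite inE => /predU1P[->|/h2].
Qed.

Lemma cell_meet_cat s1 s2 : cell_meet (s1 ++ s2) = cell_meet s1 `&` cell_meet s2.
Proof.
elim: s1 => [|c s1 ih] /=; last by rewrite !cell_meet_cons ih setIA.
by apply/seteqP; split=> [x h|x []//]; split.
Qed.

Lemma cell_meet_measurable s : measurable (cell_meet s).
Proof.
elim: s => [|c s ih]; first by rewrite (_ : cell_meet _ = setT)//; apply/seteqP.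
rewrite cell_meet_cons; apply: measurableI => //.
by apply: sub_sigma_algebra; exact: cell_open.
Qed.

Lemma step_product01 s n a : 0 <= step_product s n a <= 1.
Proof.
rewrite /step_product; elim/big_ind : _ => [|u v /andP[u0 u1] /andP[v0 v1]|c _].
- by rewrite ler01 lexx.
- by rewrite mulr_ge0//= mulr_ile1.
- by apply: poly_step01; exact: bump01.
Qed.

Lemma step_product_cvg s x :
  step_product s n (repr x) @[n --> \oo] --> (\1_(cell_meet s) x : R).
Proof.
elim: s => [|c s ih].
  rewrite (_ : cell_meet _ = setT); last by apply/seteqP.
  rewrite indicT (_ : (fun _ => _) = cst 1); first exact: cvg_cst.
  by apply/funext => n; rewrite /step_product big_nil.
rewrite cell_meet_cons indicI.
rewrite (_ : (fun _ => _) = fun n => poly_step c.2.+1 n (tbump (map_mx ratr c.1) x) *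
    step_product s n (repr x)); last by apply/funext => n; rewrite /step_product big_cons.
apply: cvgM => //.
have := @poly_step_cvg R c.2.+1 _ (ltn0Sn _) (tbump01 (map_mx ratr c.1) x).
rewrite indicE; congr (_ --> _).
case: ifPn => h; first by rewrite mem_set.
by rewrite memNset//=; apply/negP.
Qed.

Lemma separating_continuous N : continuous (separating N).
Proof. by apply/continuous_torusP; exact: bnd_continuous (separating_bnd N). Qed.

Lemma step_product_pairing (mu nu : P) s n :
  (forall N, pairing (separating N) mu = pairing (separating N) nu) ->
  pairing (fun x => step_product s n (repr x)) mu =
  pairing (fun x => step_product s n (repr x)) nu.
Proof.
move=> h; have B0 := step_bound_gt0 s n.
have := h (pickle (s, n)).
have E : (fun x : T => step_product s n (repr x)) =
    fun x => step_bound s n * separating (pickle (s, n)) x.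
  apply/funext => x; rewrite /separating pickleK mulrA divff ?mul1r//.
  by rewrite gt_eqF.
have hi (m : P) : m.-integrable setT (EFin \o separating (pickle (s, n))).
  have c := @separating_continuous (pickle (s, n)); have [M hM] := torus_bounded c.
  exact: bounded_integrable (continuous_torus_measurable c) hM.
by rewrite E /pairing (RintegralZl _ measurableT (hi mu)) (RintegralZl _ measurableT (hi nu)) => ->.
Qed.

(** Finite intersections of cells form a pi-system that generates the Borel sets, the cells being a
    countable base. The measures agree on each of them, its indicator being a bounded pointwise
    limit of step products. *)
Lemma separating_eq (mu nu : P) :
  (forall N, pairing (separating N) mu = pairing (separating N) nu) ->
  measure_eq mu nu.
Proof.
move=> h.
have eqs s : mu (cell_meet s) = nu (cell_meet s).
  have lim (m : P) : pairing (fun x => step_product s n (repr x)) m @[n --> \oo] -->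
      fine (m (cell_meet s)).
    have -> : fine (m (cell_meet s)) = \int[m]_x \1_(cell_meet s) x.
      by rewrite /Rintegral integral_indic ?setIT//; exact: cell_meet_measurable.
    apply: (@bounded_convergence _ _ _ _ _ _ 1).
    - move=> n; apply: continuous_torus_measurable; apply/continuous_torusP.
      have [M hM] := smooth_bounded_step_product s n 1%N.
      rewrite (_ : (fun _ => _) = step_product s n); first exact: bnd_continuous hM.
      by apply/funext => a; apply: step_product_periodic; rewrite reprK.
    - by apply: measurable_indic; exact: cell_meet_measurable.
    - by move=> n x; have /andP[h0 h1] := step_product01 s n (repr x); rewrite ger0_norm.
    - exact: step_product_cvg.
  have : fine (mu (cell_meet s)) = fine (nu (cell_meet s)).
    apply: (cvg_unique _ (lim mu)) => //.
    rewrite /= (_ : (fun n => _) = fun n => pairing (fun x => step_product s n (repr x)) nu).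
      exact: lim.
    by apply/funext => n; exact: step_product_pairing.
  have mf (m : P) : m (cell_meet s) \is a fin_num.
    by apply: fin_num_measure; exact: cell_meet_measurable.
  by move=> e; rewrite -(fineK (mf mu)) -(fineK (mf nu)) e.
pose G : set (set T) := [set cell_meet s | s in setT].
move=> A mA.
apply: (@g_sigma_algebra_measure_unique _ R T G _ (fun=> setT) _ _ mu nu) => //.
- by move=> _ [s _ <-]; exact: cell_meet_measurable.
- by move=> _; exists [::] => //; apply/seteqP.
- by apply/seteqP; split=> // x _; exists 0%N.
- move=> _ _ [s1 _ <-] [s2 _ <-]; exists (s1 ++ s2) => //; exact: cell_meet_cat.
- by move=> _ [s _ <-]; exact: eqs.
- by move=> _; apply: le_lt_trans (probability_le1 mu measurableT) (ltry _).
apply: (smallest_sub (smallest_sigma_algebra setT G) _ mA) => B /= oB.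
have -> : B = \bigcup_n (if `[< cells n `<=` B >] then cells n else set0).
  apply/seteqP; split=> x.
    move=> Bx; have [c [cx cB]] := cell_base oB Bx.
    exists (pickle c) => //; rewrite /cells pickleK.
    by case: asboolP.
  by move=> [n _]; case: asboolP => // h'; exact: h'.
apply: (@bigcupT_measurable _ (g_sigma_algebraType G)) => n.
case: asboolP => _; last exact: measurable0.
rewrite /cells; case: unpickle => [c|]; last exact: measurable0.
apply: sub_sigma_algebra; exists [:: c] => //.
by rewrite cell_meet_cons; apply/seteqP; split=> x; [case|].
Qed.

End separating_family.

(** * Calculus on the torus and the Hamiltonian *)

Section torus_calculus.
Context {R : realType} {d : nat}.
Local Notation V := 'rV[R]_d.
Local Notation T := (torus R d).
Local Notation P := (prob R d).
Implicit Types (g h : T -> R) (a b v : V) (x y : T).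

Lemma derive_tlift_periodic g v a b : \pi_T a = \pi_T b :> T ->
  'D_v (tlift g) a = 'D_v (tlift g) b.
Proof.
move=> ab; rewrite /derive.
have -> : (fun s : R => s^-1 *: ((tlift g \o shift a) (s *: v) - tlift g a)) =
    (fun s : R => s^-1 *: ((tlift g \o shift b) (s *: v) - tlift g b)).
  apply/funext => s /=; congr (_ *: (_ - _)); last by rewrite /tlift ab.
  rewrite /tlift; congr g; apply/torus_piP => i; move/torus_piP : ab => /(_ i).
  by rewrite !mxE opprD addrACA subrr add0r.
by [].
Qed.

Lemma tlift_tpderiv i g : tlift (tpderiv i g) = pderiv i (tlift g).
Proof.
by apply/funext => a; rewrite /tlift /tpderiv; apply: derive_tlift_periodic; rewrite reprK.
Qed.

Lemma torusC2_continuous g : torusC2 g -> continuous g.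
Proof.
move=> [[dg _] _]; apply/continuous_torusP => a.
exact: (differentiable_continuous (dg a)).
Qed.

Lemma torusC2_tpderiv_continuous i g : torusC2 g -> continuous (tpderiv i g).
Proof.
by move=> [[_ cg] _]; apply/continuous_torusP; rewrite -/(tlift _) tlift_tpderiv; exact: cg.
Qed.

Lemma torusC2_tpderiv2_continuous i j g : torusC2 g -> continuous (tpderiv j (tpderiv i g)).
Proof.
move=> [_ h]; apply/continuous_torusP; rewrite -/(tlift _) !tlift_tpderiv.
by have [_] := h (delta_mx ord0 i); exact.
Qed.

Lemma continuous_sum (S : topologicalType) (I : Type) (r : seq I) (f : I -> S -> R) :
  (forall i, continuous (f i)) -> continuous (fun s : S => \sum_(i <- r) f i s).
Proof.
move=> cf; elim: r => [|i r ih].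
  rewrite (_ : (fun _ => _) = cst 0); first exact: cst_continuous.
  by apply/funext => s; rewrite big_nil.
rewrite (_ : (fun _ => _) = fun s => f i s + \sum_(i <- r) f i s).
  by move=> s; apply: cvgD; [exact: cf|exact: ih].
by apply/funext => s; rewrite big_cons.
Qed.

Lemma torusC2_tlaplacian_continuous g : torusC2 g -> continuous (tlaplacian g).
Proof.
by move=> cg; apply: continuous_sum => i; exact: torusC2_tpderiv2_continuous.
Qed.

Lemma continuous_lin (S : topologicalType) (f1 f2 : S -> R) (c : R) :
  continuous f1 -> continuous f2 -> continuous (fun s : S => f1 s + c * f2 s).
Proof.
by move=> c1 c2 s; apply: cvgD; [exact: c1|apply: cvgMr; exact: c2].
Qed.

Lemma continuous_addr (S : topologicalType) (f1 f2 : S -> R) :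
  continuous f1 -> continuous f2 -> continuous (fun s : S => f1 s + f2 s).
Proof. by move=> c1 c2 s; apply: cvgD; [exact: c1|exact: c2]. Qed.

Lemma continuous_subr (S : topologicalType) (f1 f2 : S -> R) :
  continuous f1 -> continuous f2 -> continuous (fun s : S => f1 s - f2 s).
Proof. by move=> c1 c2 s; apply: cvgB; [exact: c1|exact: c2]. Qed.

Lemma continuous_mulr (S : topologicalType) (f1 f2 : S -> R) :
  continuous f1 -> continuous f2 -> continuous (fun s : S => f1 s * f2 s).
Proof. by move=> c1 c2 s; apply: cvgM; [exact: c1|exact: c2]. Qed.

Lemma C1_lin (F G : V -> R) (c : R) : C1 F -> C1 G -> C1 (fun a => F a + c * G a).
Proof.
move=> [dF cF] [dG cG]; split.
  by move=> a; apply: differentiableD => //; exact: (differentiableZ c).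
move=> v; have -> : 'D_v (fun a => F a + c * G a) = fun a => 'D_v F a + c * 'D_v G a.
  apply/funext => a.
  have dGa : derivable (c *: G) a v by apply: derivableZ; exact: diff_derivable.
  rewrite (deriveD (diff_derivable (dF a)) dGa); congr (_ + _).
  by apply: (deriveZ c); exact: diff_derivable.
exact: continuous_lin (cF v) (cG v).
Qed.

Lemma derive_lin (F G : V -> R) (c : R) v : C1 F -> C1 G ->
  'D_v (fun a => F a + c * G a) = fun a => 'D_v F a + c * 'D_v G a.
Proof.
move=> [dF cF] [dG cG]; apply/funext => a.
have dGa : derivable (c *: G) a v by apply: derivableZ; exact: diff_derivable.
rewrite (deriveD (diff_derivable (dF a)) dGa); congr (_ + _).
by apply: (deriveZ c); exact: diff_derivable.
Qed.

Lemma torusC2_lin g h (c : R) : torusC2 g -> torusC2 h -> torusC2 (fun x => g x + c * h x).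
Proof.
move=> [cg c2g] [ch c2h]; split; first exact: C1_lin.
by move=> v; rewrite derive_lin//; exact: C1_lin.
Qed.

Lemma tpderiv_lin i g h (c : R) : torusC2 g -> torusC2 h ->
  tpderiv i (fun x => g x + c * h x) = fun x => tpderiv i g x + c * tpderiv i h x.
Proof.
move=> [cg _] [ch _]; apply/funext => x.
exact: (congr1 (@^~ (repr x)) (derive_lin c _ cg ch)).
Qed.

Lemma tlaplacian_lin g h (c : R) : torusC2 g -> torusC2 h ->
  tlaplacian (fun x => g x + c * h x) = fun x => tlaplacian g x + c * tlaplacian h x.
Proof.
move=> [cg c2g] [ch c2h]; apply/funext => x.
rewrite /tlaplacian mulr_sumr -big_split/=; apply: eq_bigr => i _.
rewrite tpderiv_lin// /tpderiv.
rewrite -[tlift _]/(fun a => tlift (tpderiv i g) a + c * tlift (tpderiv i h) a).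
rewrite -!/(tpderiv i _) !tlift_tpderiv.
exact: (congr1 (@^~ (repr x)) (derive_lin c _ (c2g _) (c2h _))).
Qed.

Lemma torusC2_lip g (M : R) : torusC2 g -> 0 <= M ->
  (forall i x, `|tpderiv i g x| <= M) -> torus_lip (M * d%:R) g.
Proof.
move=> [[dg _] _] M0 hM; apply: torus_lipP; first by rewrite mulr_ge0.
move=> a b; have [c _] := MVT_segment_rV b (a - b) dg.
rewrite [b + _]addrC subrK => e; rewrite -[g _]/(tlift g a) -[g (\pi_T b)]/(tlift g b) e.
rewrite derive_linform// /linform (le_trans (ler_norm_sum _ _ _))//.
apply: (@le_trans _ _ (\sum_(i < d) M * enorm (a - b))).
  apply: ler_sum => i _; rewrite normrM mulrC ler_pM//; last exact: coord_le_enorm.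
  by rewrite -tlift_tpderiv; exact: hM.
by rewrite sumr_const card_ord -[leLHS]mulr_natl mulrA [M * _]mulrC.
Qed.

Lemma torus_lip_pairing g (L e : R) (m m' : P) : 0 < L -> torus_lip L g ->
  d1_ball m e m' -> `|pairing g m - pairing g m'| <= L * e.
Proof.
move=> L0 lg; have cg := torus_lip_continuous (ltW L0) lg.
have [M hM] := torus_bounded cg; have mg := continuous_torus_measurable cg.
have gi (q : P) := bounded_integrable q mg hM.
wlog suff : m m' / d1_ball m e m' -> pairing g m - pairing g m' <= L * e.
  move=> h mm'; rewrite ler_norml h// andbT lerNl opprB h//.
  exact: d1_ball_sym.
move=> mm'; pose f x := L^-1 * g x.
have lf : lip1 f.
  move=> x y; rewrite /f -mulrBr normrM gtr0_norm ?invr_gt0//.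
  by rewrite mulrC ler_pdivrMr// mulrC lg.
have : ((pairing_sub f m m')%:E < e%:E)%E.
  by apply: le_lt_trans mm'; apply: ereal_sup_ubound; exists f.
rewrite lte_fin /pairing_sub /pairing.
rewrite (RintegralZl _ measurableT (gi m)) (RintegralZl _ measurableT (gi m')).
by rewrite -mulrBr mulrC ltr_pdivrMr// mulrC => /ltW.
Qed.

End torus_calculus.

(** * Pairings of continuous functions with measures *)

Section continuous_pairings.
Context {R : realType} {d : nat}.
Local Notation T := (torus R d).
Local Notation P := (prob R d).
Implicit Types (g h : T -> R) (m : P).

Lemma continuous_integrable g m : continuous g -> m.-integrable setT (EFin \o g).
Proof.
move=> cg; have [M hM] := torus_bounded cg.
exact: bounded_integrable (continuous_torus_measurable cg) hM.
Qed.

Lemma pairing_lin g h (c : R) m : continuous g -> continuous h ->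
  pairing (fun x => g x + c * h x) m = pairing g m + c * pairing h m.
Proof.
move=> cg ch; have gi := continuous_integrable m cg; have hi := continuous_integrable m ch.
by rewrite /pairing RintegralD ?RintegralZl//; exact: integrable_mulr.
Qed.

Lemma pairingB g h m : continuous g -> continuous h ->
  pairing (fun x => g x - h x) m = pairing g m - pairing h m.
Proof.
by move=> cg ch; rewrite /pairing RintegralB//; exact: continuous_integrable.
Qed.

Lemma pairingD g h m : continuous g -> continuous h ->
  pairing (fun x => g x + h x) m = pairing g m + pairing h m.
Proof.
by move=> cg ch; rewrite /pairing RintegralD//; exact: continuous_integrable.
Qed.

Lemma pairing_norm_le g m (M : R) : continuous g -> (forall x, `|g x| <= M) ->
  `|pairing g m| <= M.
Proof. by move=> cg hM; apply: Rintegral_norm_le => //; exact: continuous_torus_measurable. Qed.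

Lemma pairing_le0 g m : continuous g -> (forall x, g x <= 0) -> pairing g m <= 0.
Proof.
move=> cg h; rewrite -oppr_ge0 -pairingN.
by apply: Rintegral_ge0 => x _; rewrite oppr_ge0.
Qed.

(** Needed to use a probability as the signed measure in the definition of solutions. In any Hahn
    decomposition of a positive measure the negative set is null, so the Jordan parts are the
    measure and zero. *)
Lemma cpairing_charge_of_prob g m : cpairing g (charge_of_finite_measure m) = pairing g m.
Proof.
rewrite /cpairing; case: cid => p Hp; case: cid => n pn.
have [[mp hp] [mn hn] pnT pn0] := pn.
have neg0 (A : set T) : measurable A -> jordan_neg pn A = 0%E.
  move=> mA; rewrite jordan_negE cjordan_negE /crestr0 mem_set//= /crestr.
  have mAn : measurable (A `&` n) by exact: measurableI.
  have : (charge_of_finite_measure m (A `&` n) <= 0)%E by apply: hn => //; exact: subIsetr.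
  rewrite /charge_of_finite_measure => h.
  have -> : m (A `&` n) = 0%E by apply/eqP; rewrite eq_le h measure_ge0.
  by rewrite oppe0.
have pos (A : set T) : measurable A -> jordan_pos pn A = m A.
  move=> mA; have := jordan_decomp pn mA.
  rewrite /cadd/= /cscale/= neg0// mule0 adde0.
  by rewrite /charge_of_finite_measure => <-.
rewrite /pairing /Rintegral.
have -> : (\int[jordan_pos pn]_x (g x)%:E = \int[m]_x (g x)%:E)%E.
  by apply: eq_measure_integral => A mA _; exact: pos.
have -> : (\int[jordan_neg pn]_x (g x)%:E = \int[mzero]_x (g x)%:E)%E.
  by apply: eq_measure_integral => A mA _; exact: neg0.
by rewrite integral_measure_zero subr0.
Qed.

End continuous_pairings.

(** * Convexity and regularity of the Hamiltonian *)

Section convex_gradient.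
Context {R : realType} {d : nat}.
Local Notation V := 'rV[R]_d.
Local Notation T := (torus R d).

(** By convexity the difference quotient along the segment is at most [F q - F p] for steps in (0,
    1]; the bound survives as the step tends to zero from the right. *)
Lemma convex_gradient_le (F : V -> R) p q : convex_function [set: V] F ->
  differentiable F p -> F p + dotp (q - p) (\row_i pderiv i F p) <= F q.
Proof.
move=> cF dF.
have -> : dotp (q - p) (\row_i pderiv i F p) = 'D_(q - p) F p.
  by rewrite derive_linform//; apply: eq_bigr => i _; rewrite !mxE.
have : derivable F p (q - p) by exact: diff_derivable.
rewrite /derivable /derive => /cvg_ex[l hl]; rewrite (cvg_lim _ hl)//.
rewrite -lerBrDl.
have hr : (fun h : R => h^-1 *: ((F \o shift p) (h *: (q - p)) - F p)) @ 0^'+ --> l.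
  apply: cvg_trans hl; apply: cvg_app; apply: within_subset => t /=.
  exact: lt0r_neq0.
apply: (@closed_cvg _ _ (0^'+) _ _ (fun t : R => t <= F q - F p) (@closed_le R _) _ _ hr).
near=> t.
have t0 : 0 < t by near: t; exact: nbhs_right_gt.
have t1 : t <= 1 by near: t; exact: nbhs_right_ltW.
have := cF (Itv01 (ltW t0) t1) q p; rewrite !inE => /(_ Logic.I Logic.I).
move=> h0; have {h0} h : F (t *: q + (1 - t) *: p) <= t * F q + (1 - t) * F p := h0.
rewrite /GRing.scale/= mulrC ler_pdivrMr//.
rewrite (_ : t *: (q - p) + p = t *: q + (1 - t) *: p); last first.
  by rewrite scalerBr scalerBl scale1r addrAC -addrA addrCA addrA.
by apply: le_trans (lerB h (lexx _)) _; lra.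
Unshelve. all: by end_near. Qed.

Variable H : T -> V -> R.
Hypothesis HC1 : hamiltonianC1 H.

Let G (z : V * V) := H (\pi_T z.1) z.2.

(** Seen as a directional derivative in both variables, the momentum derivative is jointly
    continuous by hypothesis. *)
Lemma hamiltonian_pderiv i a p : pderiv i (H (\pi_T a)) p = 'D_(0, delta_mx ord0 i) G (a, p).
Proof.
rewrite /pderiv /derive.
have -> : (fun s : R => s^-1 *: ((H (\pi_T a) \o shift p) (s *: delta_mx ord0 i) - H (\pi_T a) p)) =
    (fun s : R => s^-1 *: ((G \o shift (a, p)) (s *: (0, delta_mx ord0 i)) - G (a, p))).
  by apply/funext => s; rewrite /G /= scaler0 add0r.
by [].
Qed.

Lemma hamiltonian_differentiable x p : differentiable (H x) p.
Proof.
have [dG _] := HC1.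
rewrite -[x]reprK (_ : H _ = G \o (fun p => (repr x, p)))//.
apply: differentiable_comp; last exact: dG.
by apply: differentiable_pair.
Qed.

Lemma hamiltonian_continuous (u : T -> V) :
  continuous (fun a : V => u (\pi_T a)) -> continuous (fun x => H x (u x)).
Proof.
move=> cu; apply/continuous_torusP => a.
have [dG _] := HC1.
apply: (@continuous_comp _ _ _ (fun b : V => (b, u (\pi_T b))) G a).
  by apply: (@cvg_pair _ _ _ (nbhs a) (nbhs a) (nbhs (u (\pi_T a)))); [exact: cvg_id|exact: cu].
exact: differentiable_continuous.
Qed.

Lemma DpH_continuous i (u : T -> V) :
  continuous (fun a : V => u (\pi_T a)) -> continuous (fun x => DpH H x (u x) ord0 i).
Proof.
move=> cu; apply/continuous_torusP => a; have [_ cG] := HC1.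
rewrite (_ : (fun _ => _) = 'D_(0, delta_mx ord0 i) G \o (fun b : V => (b, u (\pi_T b)))).
  apply: continuous_comp; last exact: cG.
  by apply: (@cvg_pair _ _ _ (nbhs a) (nbhs a) (nbhs (u (\pi_T a)))); [exact: cvg_id|exact: cu].
by apply/funext => b; rewrite /= mxE hamiltonian_pderiv.
Qed.

(** Uniform in [x] because representatives can be taken in the unit cube, so a compact product of
    two boxes is enough. *)
Lemma DpH_bounded (M : R) : exists C, forall x (p : V),
  (forall i, `|p ord0 i| <= M) -> forall i, `|DpH H x p ord0 i| <= C.
Proof.
have [_ cG] := HC1.
pose K : set (V * V) := [set a : V | forall i, `[0, 1]%classic (a ord0 i)] `*`
  [set p : V | forall i, `[- M, M]%classic (p ord0 i)].
have cK : compact K.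
  apply: compact_setX.
    by apply: (@rV_compact R d (fun=> `[0, 1]%classic)) => i; exact: segment_compact.
  by apply: (@rV_compact R d (fun=> `[- M, M]%classic)) => i; exact: segment_compact.
have h i : exists C, 0 <= C /\ forall z, K z -> `|'D_(0, delta_mx ord0 i) G z| <= C.
  have /compact_bounded : compact ('D_(0, delta_mx ord0 i) G @` K).
    by apply: continuous_compact => //; apply: continuous_subspaceT; exact: cG.
  move=> /ex_strict_bound_gt0[C C0 /= hC]; exists C; split; first exact: ltW.
  by move=> z Kz; apply/ltW/hC; exists z.
have [C hC] := choice h.
exists (\sum_i C i) => x p pM i.
have [a <- ha] := torus_repr_unit x.
rewrite mxE hamiltonian_pderiv; have [_ hi] := hC i.
apply: le_trans (hi (a, p) _) _.
  split=> j /=; rewrite in_itv/=; first exact: ha.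
  by have := pM j; rewrite ler_norml.
by rewrite (bigD1 i)//= lerDl sumr_ge0// => j _; have [] := hC j.
Qed.

End convex_gradient.

(** * The strictly convex functional *)

Section weights.
Context {R : realType}.

(** Any law that charges every integer would do. Being a probability, it turns weighted sums into
    integrals of bounded functions. *)
Definition weights : probability nat R := poisson_prob (1 : R) 0.

Lemma weights_gt0 N : (0 < weights [set N])%E.
Proof.
rewrite /weights/= /poisson_prob ltr01 esum_set1 ?lee_fin ?poisson_pmf_ge0//.
by rewrite lte_fin /poisson_pmf ltr01 expr1n mul1r mulr_gt0 ?expR_gt0// invr_gt0 ltr0n fact_gt0.
Qed.

Lemma weights_integrable (f : nat -> R) (M : R) : (forall n, `|f n| <= M) ->
  weights.-integrable setT (EFin \o f).
Proof. by move=> fM; apply: (@bounded_integrable _ _ _ _ _ M). Qed.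

Lemma weights_Rintegral_gt0 (f : nat -> R) (M : R) N :
  (forall n, `|f n| <= M) -> (forall n, 0 <= f n) -> 0 < f N ->
  0 < \int[weights]_n f n.
Proof.
move=> fM f0 fN.
have wN : (weights [set N]) \is a fin_num by exact: fin_num_measure.
apply: (@lt_le_trans _ _ (\int[weights]_n (f N * \1_[set N] n))).
  have i1 : weights.-integrable setT (EFin \o (\1_[set N] : nat -> R)).
    by apply: (@weights_integrable _ 1) => n; rewrite indicE; case: (_ \in _); rewrite ?normr1 ?normr0.
  rewrite RintegralZl// mulr_gt0// /Rintegral integral_indic// setIT fine_gt0//.
  by rewrite weights_gt0/= -ge0_fin_numE.
have i2 : weights.-integrable setT (EFin \o (fun n => f N * \1_[set N] n)).
  apply: (@weights_integrable _ (f N)) => n; rewrite indicE; case: (_ \in _).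
    by rewrite mulr1 gtr0_norm.
  by rewrite mulr0 normr0 ltW.
apply: le_Rintegral => //; first exact: weights_integrable fM.
move=> n _; rewrite indicE; have [/set_mem -> |_] := boolP (n \in [set N]).
  by rewrite mulr1.
by rewrite mulr0.
Qed.

End weights.

Section strictly_convex_functional.
Context {R : realType} {d : nat}.
Local Notation V := 'rV[R]_d.
Local Notation T := (torus R d).
Local Notation P := (prob R d).
Implicit Types (m : P) (x : T).

Definition coef (n : nat) m : R := pairing (separating n) m.

(* The convex functional Q and, up to a factor 2, its linear derivative. *)
Definition energy m : R := \int[weights]_n (coef n m ^+ 2).

Definition energy_grad m x : R := \int[weights]_n (coef n m * separating n x).

Lemma separating_le1 n x : `|separating n x| <= 1.
Proof. by rewrite -[x]reprK; exact: (bnd0 (repr x) (separating_bnd n)). Qed.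

Lemma coef_le1 n m : `|coef n m| <= 1.
Proof. apply: pairing_norm_le; [exact: separating_continuous|exact: separating_le1]. Qed.

Lemma coefM_le1 n m m' : `|coef n m * coef n m'| <= 1.
Proof. by rewrite normrM mulr_ile1// coef_le1. Qed.

(** Origin of the order four for the separating functions: integration over the index loses one
    order, and [bnd_C2] requires three. *)
Lemma energy_grad_bnd m : bnd 3 1 (tlift (energy_grad m)).
Proof.
apply: (@bnd_Rintegral _ _ weights (fun n a => coef n m * tlift (separating n) a)) => n.
apply: bnd_le (bndZ _ (separating_bnd n)).
by rewrite mulr1 coef_le1.
Qed.

Lemma energy_grad_C2 m : torusC2 (energy_grad m).
Proof. exact: bnd_C2 (energy_grad_bnd m). Qed.

Lemma energy_grad_pairing m0 m :
  pairing (energy_grad m0) m = \int[weights]_n (coef n m0 * coef n m).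
Proof.
pose f (z : T * nat) : R := coef z.2 m0 * separating z.2 z.1.
have mf : measurable_fun setT f.
  (* The second variable being discrete, a preimage is a countable union of rectangles; this gives
     the joint measurability needed for Fubini. *)
  move=> _ B mB; rewrite setTI.
  rewrite (_ : f @^-1` B = \bigcup_n
     ([set x | B (coef n m0 * separating n x)] `*` [set n])).
    apply: bigcupT_measurable => n; apply: measurableX => //.
    rewrite -[X in measurable X]setTI.
    have : measurable_fun setT (fun x => coef n m0 * separating n x).
      apply: measurable_funM => //.
      by apply: continuous_torus_measurable; exact: separating_continuous.
    exact.
  apply/seteqP; split=> [[x n] /= Bf|[x n] [k _ [/= Bf ->]]//].
  by exists n.
have f1 z : `|f z| <= 1.
  by rewrite /f normrM mulr_ile1 ?coef_le1 ?separating_le1.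
have fi : (m \x weights)%E.-integrable setT (EFin \o f).
  exact: bounded_integrable mf f1.
have := Fubini fi => /=.
have -> : (\int[m]_x \int[weights]_n (f (x, n))%:E = \int[m]_x (energy_grad m0 x)%:E)%E.
  apply: eq_integral => x _; rewrite /energy_grad /Rintegral fineK//.
  by apply: integrable_fin_num => //; apply: (@weights_integrable _ _ 1) => n; exact: (f1 (x, n)).
have -> : (\int[weights]_n \int[m]_x (f (x, n))%:E =
    \int[weights]_n (coef n m0 * coef n m)%:E)%E.
  apply: eq_integral => n _.
  have si := continuous_integrable m (@separating_continuous R d n).
  rewrite -(RintegralZl _ measurableT si) /Rintegral fineK//.
  by apply: integrable_fin_num => //; exact: integrable_mulr.
by rewrite /pairing /Rintegral => ->.
Qed.

(* Completing the square: the concave perturbation -e Q dominates its tangent,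
   strictly away from m0. *)
Lemma strict_min_perturbed (F : P -> R) (e : R) m0 : 0 < e ->
  (forall m, F m0 - e * energy m0 <= F m - e * energy m) ->
  strict_min (fun m => F m - 2 * e * pairing (energy_grad m0) m) m0.
Proof.
move=> e0 hF m neq.
have [N hN] : exists N, coef N m != coef N m0.
  apply: contrapT => h; apply: neq; apply: separating_eq => N.
  by apply/eqP; apply: contrapT => hN; apply: h; exists N; apply/negP.
have sq_i m1 m2 : weights.-integrable setT (EFin \o (fun n => coef n m1 * coef n m2)).
  by apply: (@weights_integrable _ _ 1) => n; exact: coefM_le1.
have pos : 0 < \int[weights]_n ((coef n m - coef n m0) ^+ 2).
  apply: (@weights_Rintegral_gt0 _ _ 4 N) => [n|n|].
  - rewrite normrX (_ : 4 = 2 ^+ 2); last by ring.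
    rewrite lerXn2r ?nnegrE// (le_trans (ler_normB _ _))//.
    by rewrite -[2]/(1 + 1) lerD ?coef_le1.
  - exact: sqr_ge0.
  - by rewrite lt_neqAle sqr_ge0 andbT eq_sym sqrf_eq0 subr_eq0.
have E : \int[weights]_n ((coef n m - coef n m0) ^+ 2) =
    energy m - 2 * \int[weights]_n (coef n m0 * coef n m) + energy m0.
  rewrite (_ : (fun n => _) = fun n => coef n m * coef n m -
      2 * (coef n m0 * coef n m) + coef n m0 * coef n m0); last first.
    by apply/funext => n; ring.
  rewrite RintegralD//; last first.
    by apply: integrable_subr => //; exact: integrable_mulr.
  rewrite RintegralB//; last exact: integrable_mulr.
  by rewrite RintegralZl.
have E0 : \int[weights]_n (coef n m0 * coef n m0) = energy m0 by [].
rewrite !energy_grad_pairing E0.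
have := hF m; have : 0 < e * \int[weights]_n ((coef n m - coef n m0) ^+ 2) by rewrite mulr_gt0.
by rewrite E; lra.
Qed.

Lemma energy01 m : 0 <= energy m <= 1.
Proof.
rewrite Rintegral_ge0/=; last by move=> n _; exact: sqr_ge0.
apply: le_trans (ler_norm _) _; apply: Rintegral_norm_le => // n.
by rewrite expr2 coefM_le1.
Qed.

(** A constant common to all indices, kept positive by the added 1 as [torus_lip_pairing]
    requires. *)
Lemma separating_lip n : torus_lip (d%:R + 1) (@separating R d n).
Proof.
apply: torus_lipP; first by rewrite addr_ge0.
move=> a b; apply: le_trans (bnd_lip (separating_bnd n) a b) _; rewrite mul1r.
apply: (@le_trans _ _ (\sum_(i < d) enorm (a - b))).
  by apply: ler_sum => i _; have := coord_le_enorm (a - b) i; rewrite !mxE.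
rewrite sumr_const card_ord -[leLHS]mulr_natl ler_wpM2r ?sqrtr_ge0//.
by rewrite lerDl.
Qed.

Lemma energy_continuous : continuous energy.
Proof.
move=> m; apply/(@cvgrPdist_le _ _ _ (nbhs m)) => e e0.
have L0 : 0 < d%:R + 1 :> R by rewrite ltr_wpDl.
apply/nbhs_ballP; exists (e / (2 * (d%:R + 1))); first by rewrite /= divr_gt0// mulr_gt0.
move=> m' /= mm'.
have i2 q : weights.-integrable setT (EFin \o (fun n => coef n q ^+ 2)).
  by apply: (@weights_integrable _ _ 1) => n; rewrite expr2 coefM_le1.
rewrite /energy -RintegralB//; apply: Rintegral_norm_le => // n.
rewrite subr_sqr normrM.
have h1 : `|coef n m - coef n m'| <= (d%:R + 1) * (e / (2 * (d%:R + 1))).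
  by apply: torus_lip_pairing => //; exact: separating_lip.
have h2 : `|coef n m + coef n m'| <= 2.
  by rewrite (le_trans (ler_normD _ _))// -[2]/(1 + 1) lerD ?coef_le1.
apply: le_trans (ler_pM _ _ h1 h2) _ => //.
by rewrite le_eqVlt; apply/orP; left; apply/eqP; field; rewrite gt_eqF.
Qed.

End strictly_convex_functional.

(** * Continuity in the measure and mixtures *)

Section joint_continuity.
Context {R : realType} {d : nat}.
Local Notation T := (torus R d).
Local Notation P := (prob R d).

Lemma prob_setT_compact : compact [set: P].
Proof. exact: prob_compact (@cells_measurable R d) (@cells_separating R d). Qed.

(** The tube lemma: joint continuity near each point of the compact torus becomes uniform continuity
    at the measure [m]. *)
Lemma uniform_in_x (U : T -> P -> R) (m : P) (e : R) : jointly_continuous U -> 0 < e ->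
  \forall m' \near m, forall x, `|U x m' - U x m| <= e.
Proof.
move=> cU e0; have e2 : 0 < e / 2 by rewrite divr_gt0.
have /compact_near_coveringP nc := @torus_compact R d.
have : \forall m' \near m, [set: T] `<=` (fun x => `|U x m' - U x m| <= e).
  apply: (nc P (nbhs m) (fun m' x => `|U x m' - U x m| <= e)) => x _.
  have /(@cvgrPdist_le _ _ _ (nbhs (x, m))) /(_ _ e2) [[A B] /= [Ax Bm] AB] := cU (x, m).
  exists (A, B) => //= -[y m'] [/= Ay Bm'].
  have h1 := AB (y, m') (conj Ay Bm').
  have h2 := AB (y, m) (conj Ay (nbhs_singleton Bm)).
  move: h1 h2; rewrite /= !ler_norml => /andP[? ?] /andP[? ?].
  by apply/andP; split; lra.
by apply: filterS => m' h x; exact: h.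
Qed.

Lemma jointly_continuous_slice (U : T -> P -> R) m : jointly_continuous U ->
  continuous (U ^~ m).
Proof.
move=> cU x; apply: (@continuous_comp _ _ _ (fun y : T => (y, m)) (fun z => U z.1 z.2) x).
  by apply: (@cvg_pair _ _ _ (nbhs x) (nbhs x) (nbhs m)); [exact: cvg_id|exact: cvg_cst].
exact: cU.
Qed.

Lemma torusC2_lip_exists (g : T -> R) : torusC2 g -> exists2 L : R, 0 < L & torus_lip L g.
Proof.
move=> cg.
have h i : exists M, forall x, `|tpderiv i g x| <= M.
  by apply: torus_bounded; exact: torusC2_tpderiv_continuous.
have [M hM] := choice h.
pose K := \sum_i `|M i|.
have K0 : 0 <= K by exact: sumr_ge0.
exists (K * d%:R + 1); first by rewrite ltr_wpDl// mulr_ge0.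
move=> x y; apply: le_trans (torusC2_lip cg K0 _ x y) _.
  move=> i z; apply: le_trans (hM i z) _; apply: le_trans (ler_norm _) _.
  by rewrite /K (bigD1 i)//= lerDl sumr_ge0.
by rewrite ler_wpM2r ?tdist_ge0// lerDl.
Qed.

(** The function varies by uniform convergence. The measure varies against the fixed limit function,
    which is Lipschitz because it is C^2 on the torus, hence controlled by [d1]. *)
Lemma pairing_continuous (U : T -> P -> R) : jointly_continuous U ->
  (forall m, torusC2 (U ^~ m)) ->
  continuous (fun z : P * P => pairing (U ^~ z.1) z.2).
Proof.
move=> cU cU2 [mu nu]; apply/(@cvgrPdist_le _ _ _ (nbhs (mu, nu))) => e e0 /=.
have e2 : 0 < e / 2 by rewrite divr_gt0.
have [L L0 hL] := torusC2_lip_exists (cU2 mu).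
have hU := uniform_in_x mu cU e2.
exists ([set m' | forall x, `|U x m' - U x mu| <= e / 2], ball nu (e / 2 / L)) => /=.
  by split=> //; apply: nbhsx_ballx; exact: divr_gt0.
move=> [mu' nu'] [/= h1 h2].
have c1 := jointly_continuous_slice (m := mu) cU.
have c2 := jointly_continuous_slice (m := mu') cU.
have k1 : `|pairing (U ^~ mu) nu - pairing (U ^~ mu) nu'| <= e / 2.
  apply: le_trans (torus_lip_pairing L0 hL h2) _.
  by rewrite mulrC divfK// gt_eqF.
have k2 : `|pairing (U ^~ mu') nu' - pairing (U ^~ mu) nu'| <= e / 2.
  by rewrite -pairingB//; apply: pairing_norm_le => //; exact: continuous_subr.
move: k1 k2; rewrite !ler_norml => /andP[? ?] /andP[? ?].
by apply/andP; split; lra.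
Qed.

End joint_continuity.

(** * Convex combinations of measures *)

Section mixture_probability.
Context {R : realType} {d : nat} (mu nu : prob R d) (a b : {nonneg R}).

Definition mixture (ab : a%:num + b%:num = 1) : set (torus R d) -> \bar R :=
  measure_add (mscale a mu) (mscale b nu).

Hypothesis ab : a%:num + b%:num = 1.

HB.instance Definition _ := Measure.on (mixture ab).

Let mixture_setT : mixture ab setT = 1%E.
Proof.
rewrite /mixture measure_addE.
have eT (q : prob R d) k : mscale k q setT = k%:num%:E.
  by rewrite -[LHS]/(k%:num%:E * q setT)%E (probability_setT q) mule1.
transitivity (a%:num%:E + b%:num%:E)%E; first by congr (_ + _)%E; exact: eT.
by rewrite -EFinD ab.
Qed.

HB.instance Definition _ := Measure_isProbability.Build _ _ _ (mixture ab) mixture_setT.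

End mixture_probability.

Section mixtures.
Context {R : realType} {d : nat}.
Local Notation T := (torus R d).
Local Notation P := (prob R d).

Lemma mixture_exists (mu nu : P) (t : R) : 0 <= t <= 1 ->
  exists m : P, forall g : T -> R, continuous g ->
    pairing g m = (1 - t) * pairing g mu + t * pairing g nu.
Proof.
move=> /andP[t0 t1]; have s0 : 0 <= 1 - t by rewrite subr_ge0.
have ab : (NngNum s0)%:num + (NngNum t0)%:num = 1 :> R by rewrite /= subrK.
pose m : P := mixture mu nu ab.
exists m => g cg.
have [M hM] := torus_bounded cg.
(* Additivity in the measure is applied to nonnegative functions; adding the bound [M] reduces a
   general [g] to that case. *)
suff ge0 (h : T -> R) : continuous h -> (forall x, 0 <= h x) ->
    pairing h m = (1 - t) * pairing h mu + t * pairing h nu.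
  have cM : continuous (cst M : T -> R) by exact: cst_continuous.
  have c : continuous (fun x : T => g x + M) by exact: continuous_addr cg cM.
  have := ge0 _ c; rewrite !(pairingD _ cg cM) {2 4 6}/pairing !Rintegral_cst_prob => /(_ _) e.
  have : pairing g m + M = (1 - t) * (pairing g mu + M) + t * (pairing g nu + M).
    by apply: e => x; have := hM x; rewrite ler_norml => /andP[+ _]; rewrite -subr_ge0 opprK.
  lra.
move=> ch h0; have mh := continuous_torus_measurable ch.
have meh : measurable_fun setT (EFin \o h) by exact/measurable_EFinP.
have h0' x : setT x -> (0 <= (EFin \o h) x)%E by move=> _; rewrite /= lee_fin.
rewrite /pairing /Rintegral.
have -> : (\int[m]_x (h x)%:E = (1 - t)%:E * \int[mu]_x (h x)%:E + t%:E * \int[nu]_x (h x)%:E)%E.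
  rewrite -[LHS]/(\int[measure_add (mscale (NngNum s0) mu) (mscale (NngNum t0) nu)]_x (EFin \o h) x)%E ge0_integral_measure_add//.
  by rewrite !ge0_integral_mscale.
have f1 (q : P) : (\int[q]_x (h x)%:E)%E \is a fin_num.
  by apply: integrable_fin_num => //; exact: continuous_integrable.
by rewrite fineD ?fineM ?fin_numM.
Qed.

Lemma mixture_d1 (mu nu m : P) (t : R) : 0 <= t <= 1 ->
  (forall g : T -> R, continuous g -> pairing g m = (1 - t) * pairing g mu + t * pairing g nu) ->
  (d1 mu m <= (t * (2 * d%:R))%:E)%E.
Proof.
move=> /andP[t0 t1] hm; apply: ub_ereal_sup => _ [phi lphi <-]; rewrite lee_fin.
have cphi := lip1_continuous lphi.
rewrite /pairing_sub hm//.
have c0 : continuous (cst (phi point) : T -> R) by exact: cst_continuous.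
have b (q : P) : `|pairing phi q - phi point| <= d%:R.
  have <- : pairing (cst (phi point)) q = phi point by exact: Rintegral_cst_prob.
  rewrite -pairingB//; apply: pairing_norm_le => [|x].
    exact: continuous_subr.
  by apply: le_trans (lphi _ _) (tdist_le_dim _ _).
have := b mu; have := b nu; rewrite !ler_norml => /andP[? ?] /andP[? ?].
rewrite [leLHS](_ : _ = t * (pairing phi mu - pairing phi nu)); last by ring.
by rewrite ler_wpM2l//; lra.
Qed.

End mixtures.

(** * Comparison of monotone solutions *)

Section real_inequalities.
Context {R : realType}.

(** [Lu], [Lv], [Lp] are Laplacians integrated at the minimiser, and [L2] is the Laplacian of the
    solution at the other measure. [sigma * Lu] occurs in the equation and in the test term alike,
    and drops out. *)
Lemma solution_ineq_arith (r sigma e C D F1 F2 G Gp Lu Lv Lp P1 P2 H1 H2 L2 : R) :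
  e * Gp <= e * (D * C) -> - (e * sigma * D) <= e * sigma * Lp ->
  F1 - F2 - - (G + - e * Gp) - sigma * (Lu + -1 * Lv + - e * Lp) <=
    r * (P1 - P2) + (H1 + - sigma * Lu - (H2 + - sigma * L2)) ->
  F1 - F2 + G + sigma * Lv - e * (D * C + sigma * D) <=
    r * (P1 - P2) + H1 + sigma * L2 - H2.
Proof. by move=> *; lra. Qed.

Lemma perturbed_value_arith (w w1 e q s : R) : w - e * q <= w1 - e * s ->
  q <= 2 -> 0 <= s -> 0 <= e -> 8 * e <= - w1 -> w <= w1 / 2.
Proof.
move=> h q2 s0 e0 ew; have := ler_wpM2l e0 q2; have := mulr_ge0 e0 s0; lra.
Qed.

(** On adding the two inequalities [L1] and [L2] cancel, each occurring once on either side. The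
    four Hamiltonian pairings are absorbed by [G1] and [G2], leaving -4 e K <= r w / 2; hence the
    8. *)
Lemma comparison_arith (r sigma e K w f1 f2 f3 f4 G1 G2 L1 L2 U1 U2 V1 V2
    A1 A2 B1 B2 : R) :
  0 <= (f1 - f4) - (f2 - f3) -> A1 - B1 <= G1 -> B2 - A2 <= G2 ->
  f1 - f2 + G1 + sigma * L1 - 2 * e * K <= r * (U1 - U2) + A1 + sigma * L2 - A2 ->
  f3 - f4 + G2 + sigma * L2 - 2 * e * K <= r * (V2 - V1) + B2 + sigma * L1 - B1 ->
  r * (U1 - U2 - V1 + V2) <= r * (w / 2) -> 8 * (e * K) < r * - w -> False.
Proof. by move=> *; lra. Qed.

Lemma eq_up_to_constant_arith (dl u1 u2 v1 v2 w1 w2 : R) :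
  dl = u1 - v1 - (u2 - v2) -> dl < 0 -> 0 <= w1 - v1 - (w2 - v2) ->
  `|w2 - u2| <= - dl / 4 -> `|w1 - u1| <= - dl / 4 -> False.
Proof. by rewrite !ler_norml => ? ? ? /andP[? ?] /andP[? ?]; lra. Qed.

End real_inequalities.

Section monotone_solutions.
Context {R : realType} {d : nat}.
Local Notation T := (torus R d).
Local Notation P := (prob R d).
Implicit Types (g u v psi phi : T -> R) (x : T) (m mu nu : P).

Lemma tsupnorm_ub g x : (`|g x|%:E <= tsupnorm g)%E.
Proof. by apply: ereal_sup_ubound; exists x. Qed.

Lemma tsupnorm_ge0 g : (0 <= tsupnorm g)%E.
Proof. by apply: le_trans (tsupnorm_ub g point); rewrite lee_fin. Qed.

Lemma tpderiv_le_C2norm g i x : (`|tpderiv i g x|%:E <= C2norm g)%E.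
Proof.
apply: le_trans (tsupnorm_ub _ x) _.
have s2 : (0 <= \sum_(i < d) \sum_(j < d) tsupnorm (tpderiv i (tpderiv j g)))%E.
  by apply: sume_ge0 => k _; apply: sume_ge0 => j _; exact: tsupnorm_ge0.
have s1 : (tsupnorm (tpderiv i g) <= \sum_(i < d) tsupnorm (tpderiv i g))%E.
  rewrite (bigD1 i)//= leeDl//; apply: sume_ge0 => j _; exact: tsupnorm_ge0.
apply: le_trans s1 _; rewrite /C2norm.
apply: (@le_trans _ _ (tsupnorm g + \sum_(i < d) tsupnorm (tpderiv i g))%E).
  by rewrite leeDr// tsupnorm_ge0.
by rewrite leeDl.
Qed.

Lemma class_B_tpderiv_bounded U : class_B U ->
  exists M : R, forall m i x, `|tpderiv i (U ^~ m) x| <= M.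
Proof.
move=> [_ _ fin]; set N := ereal_sup _ in fin; exists (fine N) => m i x.
have h : (`|tpderiv i (U ^~ m) x|%:E <= N)%E.
  by apply: le_trans (tpderiv_le_C2norm _ _ _) _; apply: ereal_sup_ubound; exists m.
have Nfin : N \is a fin_num.
  by rewrite ge0_fin_numE// (le_trans _ h)// lee_fin.
by rewrite -lee_fin fineK.
Qed.

Lemma tgrad_lin g h c : torusC2 g -> torusC2 h ->
  tgrad (fun x => g x + c * h x) = fun x => tgrad g x + c *: tgrad h x.
Proof.
move=> cg ch; apply/funext => x; apply/rowP => i; rewrite !mxE.
by rewrite tpderiv_lin.
Qed.

Lemma tgrad_pi_continuous u : torusC2 u -> continuous (fun a : 'rV[R]_d => tgrad u (\pi_T a)).
Proof.
move=> cu a B /nbhs_ballP[e /= e0 hB].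
have h : nbhs a [set b | forall i, `|tpderiv i u (\pi_T a) - tpderiv i u (\pi_T b)| < e].
  apply: (@filter_forall _ 'I_d (fun i b => `|tpderiv i u (\pi_T a) - tpderiv i u (\pi_T b)| < e)
    (nbhs a) (nbhs_filter a)) => i.
  have /continuous_torusP ci := torusC2_tpderiv_continuous (i := i) cu.
  exact: (@cvgrPdist_lt _ _ _ (nbhs a) _ _ _).1 (ci a) e e0.
apply: (filterS _ h) => b hb; apply: hB; rewrite mx_norm_ball /ball_/=.
by rewrite [ltLHS]mx_normrE bigmax_lt// => -[i j] _ /=; rewrite !mxE; exact: hb.
Qed.

Lemma dotp_continuous (p q : T -> 'rV[R]_d) :
  (forall i, continuous (fun x => p x ord0 i)) -> (forall i, continuous (fun x => q x ord0 i)) ->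
  continuous (fun x => dotp (p x) (q x)).
Proof. by move=> cp cq; apply: continuous_sum => i; exact: continuous_mulr. Qed.

Lemma tgrad_coord_continuous u i : torusC2 u -> continuous (fun x => tgrad u x ord0 i).
Proof.
move=> cu; rewrite (_ : (fun _ => _) = tpderiv i u); first exact: torusC2_tpderiv_continuous.
by apply/funext => x; rewrite mxE.
Qed.

Lemma energy_grad_tpderiv_le1 m i x : `|tpderiv i (energy_grad m) x| <= 1.
Proof.
rewrite -[x]reprK -[tpderiv _ _ _]/(tlift (tpderiv i (energy_grad m)) (repr x)) tlift_tpderiv.
by have /bndSP[_ _ /(_ i) /bnd0] := energy_grad_bnd m.
Qed.

Lemma energy_grad_tlaplacian_le m x : `|tlaplacian (energy_grad m) x| <= d%:R.
Proof.
rewrite /tlaplacian (le_trans (ler_norm_sum _ _ _))//.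
apply: (@le_trans _ _ (\sum_(i < d) (1 : R))); last by rewrite sumr_const card_ord.
apply: ler_sum => i _.
rewrite -[x]reprK -[tpderiv _ _ _]/(tlift (tpderiv i (tpderiv i (energy_grad m))) (repr x)).
rewrite !tlift_tpderiv.
by have /bndSP[_ _ /(_ i) /bndSP[_ _ /(_ i) /bnd0]] := energy_grad_bnd m.
Qed.

Lemma continuous_comp2 (X Y Z A : topologicalType) (F : Y * Z -> A) (a : X -> Y) (b : X -> Z) :
  continuous F -> continuous a -> continuous b -> continuous (fun s : X => F (a s, b s)).
Proof.
move=> cF ca cb s; apply: (@continuous_comp _ _ _ (fun s : X => (a s, b s)) F); last exact: cF.
exact: (@cvg_pair _ _ _ (nbhs s) (nbhs (a s)) (nbhs (b s)) _ _ _ a b (ca s) (cb s)).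
Qed.

Lemma continuous_fst (X Y : topologicalType) : continuous (@fst X Y).
Proof. by move=> z; exact: cvg_fst. Qed.

Lemma continuous_snd (X Y : topologicalType) : continuous (@snd X Y).
Proof. by move=> z; exact: cvg_snd. Qed.

Lemma gapE U V mu nu : class_B U -> class_B V ->
  pairing_sub (fun x => U x mu - V x nu) mu nu =
  pairing (U ^~ mu) mu - pairing (U ^~ mu) nu - pairing (V ^~ nu) mu + pairing (V ^~ nu) nu.
Proof.
move=> [cU _ _] [cV _ _].
have slU := jointly_continuous_slice (m := mu) cU.
have slV := jointly_continuous_slice (m := nu) cV.
by rewrite /pairing_sub !(pairingB _ slU slV); ring.
Qed.

Lemma gap_continuous U V : class_B U -> class_B V ->
  continuous (fun z : P * P => pairing_sub (fun x => U x z.1 - V x z.2) z.1 z.2).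
Proof.
move=> BU BV; under eq_fun do rewrite gapE//.
have [cU cU2 _] := BU; have [cV cV2 _] := BV.
have cUp := pairing_continuous cU cU2; have cVp := pairing_continuous cV cV2.
have c1 := @continuous_fst P P; have c2 := @continuous_snd P P.
have c11 := continuous_comp2 cUp c1 c1; have c12 := continuous_comp2 cUp c1 c2.
have c21 := continuous_comp2 cVp c2 c1; have c22 := continuous_comp2 cVp c2 c2.
exact: (continuous_addr (continuous_subr (continuous_subr c11 c12) c21) c22).
Qed.

Section fixed_equation.
Variables (r sigma : R) (H : T -> 'rV[R]_d -> R) (f : T -> P -> R).
Hypothesis sigma_gt0 : 0 < sigma.
Hypothesis HC1 : hamiltonianC1 H.
Hypothesis f_continuous : jointly_continuous f.

(** The definition is applied with test function [v + e * psi] and reference measure [nu]. The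
    contribution of [psi] is bounded through [C] and [d] alone, so the error does not depend on the
    measures. *)
Lemma solution_ineq U (mu nu : P) v psi (e C : R) :
  monotone_solution r sigma H f U -> torusC2 v -> torusC2 psi -> 0 <= e ->
  (forall i x, `|tpderiv i psi x| <= 1) -> (forall x, `|tlaplacian psi x| <= d%:R) ->
  (forall i x, `|DpH H x (tgrad (U ^~ mu) x) ord0 i| <= C) ->
  strict_min (fun m => pairing_sub (fun x => U x m - v x) m nu - e * pairing psi m) mu ->
  pairing_sub (f ^~ mu) mu nu
    + pairing (fun x => dotp (tgrad (U ^~ mu) x - tgrad v x) (DpH H x (tgrad (U ^~ mu) x))) mu
    + sigma * pairing (tlaplacian v) mu - e * (d%:R * C + sigma * d%:R)
  <= r * pairing_sub (U ^~ mu) mu nu + pairing (fun x => H x (tgrad (U ^~ mu) x)) mu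
     + sigma * pairing (tlaplacian (U ^~ mu)) nu - pairing (fun x => H x (tgrad (U ^~ mu) x)) nu.
Proof.
move=> [[cU cU2 _] sol] cv cpsi e0 psi1 psi2 DC smin.
set u := U ^~ mu; set hu := fun x => H x (tgrad u x).
have cu : torusC2 u by exact: cU2.
pose phi x := v x + e * psi x.
have cphi : torusC2 phi by exact: torusC2_lin.
have cc g : torusC2 g -> continuous g by exact: torusC2_continuous.
have cl g : torusC2 g -> continuous (tlaplacian g) by exact: torusC2_tlaplacian_continuous.
(* The two functionals differ by [e * pairing psi nu], which does not depend on [m]. *)
have smin' : strict_min (fun m => pairing_csub (fun x => U x m - phi x) m
    (charge_of_finite_measure nu)) mu.
  rewrite (_ : (fun m => _) = fun m => pairing_sub (fun x => U x m - v x) m nu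
      - e * pairing psi m + e * pairing psi nu).
    by move=> m mm; rewrite ltrD2r; exact: smin.
  apply/funext => m; rewrite /pairing_csub cpairing_charge_of_prob /pairing_sub.
  have cm := cc _ (cU2 m).
  rewrite !(pairingB _ cm (cc _ cphi)) !(pairingB _ cm (cc _ cv)).
  by rewrite !(pairing_lin _ _ (cc _ cv) (cc _ cpsi)); ring.
have := sol phi (charge_of_finite_measure nu) mu cphi smin'; cbv zeta.
rewrite -/u /pairing_csub !cpairing_charge_of_prob /pairing_div /pairing_laplacian.
set b := fun x => DpH H x (tgrad u x).
have cb i : continuous (fun x => b x ord0 i).
  by apply: DpH_continuous => //; exact: tgrad_pi_continuous.
have chu : continuous hu by apply: hamiltonian_continuous => //; exact: tgrad_pi_continuous.
have cgr g : torusC2 g -> continuous (fun x => dotp (tgrad g x) (b x)).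
  by move=> cg; apply: dotp_continuous => // i; exact: tgrad_coord_continuous.
have uphiE : (fun x => u x - phi x) = fun x => (u x + (-1) * v x) + (- e) * psi x.
  by apply/funext => x; rewrite /phi; ring.
have cuv : torusC2 (fun x => u x + (-1) * v x) by exact: torusC2_lin.
rewrite uphiE (tgrad_lin _ cuv cpsi) (tgrad_lin _ cu cv) (tlaplacian_lin _ cuv cpsi) (tlaplacian_lin _ cu cv).
have -> : (fun x => dotp (tgrad u x + -1 *: tgrad v x + - e *: tgrad psi x) (b x)) =
    fun x => dotp (tgrad u x - tgrad v x) (b x) + (- e) * dotp (tgrad psi x) (b x).
  by apply/funext => x; rewrite dotp_addl dotp_scalel scaleN1r.
have cuvb : continuous (fun x => dotp (tgrad u x - tgrad v x) (b x)).
  rewrite (_ : (fun _ => _) = fun x => dotp (tgrad u x) (b x) - dotp (tgrad v x) (b x)).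
    by apply: continuous_subr; exact: cgr.
  by apply/funext => x; rewrite dotp_addl -scaleN1r dotp_scalel mulN1r.
rewrite (pairing_lin _ _ cuvb (cgr _ cpsi)).
have clin : continuous (fun x => tlaplacian u x + (-1) * tlaplacian v x).
  by apply: continuous_lin; exact: cl.
rewrite (pairing_lin _ _ clin (cl _ cpsi)) (pairing_lin _ _ (cl _ cu) (cl _ cv)).
have sE m : pairing (fun x => - sigma * tlaplacian u x + H x (tgrad u x)) m =
    pairing hu m + (- sigma) * pairing (tlaplacian u) m.
  rewrite -(pairing_lin _ _ chu (cl _ cu)); congr (pairing _ m); apply/funext => x.
  by rewrite addrC.
rewrite !sE /pairing_sub.
have b1 : `|pairing (fun x => dotp (tgrad psi x) (b x)) mu| <= d%:R * C.
  apply: pairing_norm_le => [|x]; first exact: cgr.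
  rewrite (le_trans (ler_norm_sum _ _ _))//.
  apply: (@le_trans _ _ (\sum_(i < d) C)); last by rewrite sumr_const card_ord mulr_natl.
  apply: ler_sum => i _; rewrite normrM mxE -[leRHS]mul1r ler_pM//.
  exact: DC.
have b2 : `|pairing (tlaplacian psi) mu| <= d%:R.
  by apply: pairing_norm_le => //; exact: cl.
have b1' : e * pairing (fun x => dotp (tgrad psi x) (b x)) mu <= e * (d%:R * C).
  by rewrite ler_wpM2l// (le_trans (ler_norm _)).
have b2' : - (e * sigma * d%:R) <= e * sigma * pairing (tlaplacian psi) mu.
  rewrite -mulrN ler_wpM2l// ?mulr_ge0 ?(ltW sigma_gt0)//.
  by move: b2; rewrite ler_norml => /andP[].
exact: solution_ineq_arith.
Qed.

Hypothesis r_gt0 : 0 < r.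
Hypothesis H_convex : forall x, convex_function [set: 'rV[R]_d] (H x).
Hypothesis f_monotone : monotone_map f.

Lemma comparison U V : monotone_solution r sigma H f U ->
  monotone_solution r sigma H f V ->
  forall mu nu, 0 <= pairing_sub (fun x => U x mu - V x nu) mu nu.
Proof.
move=> sU sV; pose W mu nu := pairing_sub (fun x => U x mu - V x nu) mu nu.
have [[_ cU2 _] _] := sU; have [[_ cV2 _] _] := sV.
have [MU hMU] := class_B_tpderiv_bounded sU.1.
have [MV hMV] := class_B_tpderiv_bounded sV.1.
have [CU hCU] := DpH_bounded HC1 MU; have [CV hCV] := DpH_bounded HC1 MV.
pose C := `|CU| + `|CV|.
have bCU m i x : `|DpH H x (tgrad (U ^~ m) x) ord0 i| <= C.
  apply: le_trans (hCU x _ _ i) _; first by move=> j; rewrite mxE.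
  by rewrite (le_trans (ler_norm _))// lerDl.
have bCV m i x : `|DpH H x (tgrad (V ^~ m) x) ord0 i| <= C.
  apply: le_trans (hCV x _ _ i) _; first by move=> j; rewrite mxE.
  by rewrite (le_trans (ler_norm _))// lerDr.
pose K := d%:R * C + sigma * d%:R.
have K0 : 0 <= K by rewrite addr_ge0 ?mulr_ge0 ?addr_ge0// ltW.
have WE mu nu : W mu nu = pairing (U ^~ mu) mu - pairing (U ^~ mu) nu
     - pairing (V ^~ nu) mu + pairing (V ^~ nu) nu.
  exact: gapE sU.1 sV.1.
have Wsym mu nu : pairing_sub (fun x => V x nu - U x mu) nu mu = W mu nu.
  by rewrite WE (gapE _ _ sV.1 sU.1); ring.
have Wc : continuous (fun z : P * P => W z.1 z.2) by exact: gap_continuous sU.1 sV.1.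
move=> mu1 nu1; rewrite leNgt; apply/negP => neg; rewrite -/(W mu1 nu1) in neg.
pose dl := - W mu1 nu1.
have dl0 : 0 < dl by rewrite oppr_gt0.
(* The first bound keeps W at the perturbed minimiser below half its value at the given pair, the
   energies being at most 1. The second makes the total error 4 e K smaller than half of
   [r * dl]. *)
pose e := Num.min (dl / 8) (r * dl / (8 * (K + 1))).
have K1 : 0 < K + 1 by rewrite ltr_wpDl.
have e0 : 0 < e.
  by rewrite lt_min divr_gt0//= divr_gt0// mulr_gt0.
have eK : 8 * (e * K) < r * dl.
  have : e <= r * dl / (8 * (K + 1)) by rewrite ge_min lexx orbT.
  rewrite ler_pdivlMr ?mulr_gt0//; apply: lt_le_trans.
  by rewrite mulrCA ltr_pM2l// ltr_pM2l// ltrDl.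
have edl : 8 * e <= dl.
  have : e <= dl / 8 by rewrite ge_min lexx.
  by rewrite ler_pdivlMr// mulrC.
pose Psi (z : P * P) := W z.1 z.2 - e * (energy z.1 + energy z.2).
have Psic : continuous Psi.
  have cE := @energy_continuous R d.
  have cE1 z : {for z, continuous (fun z : P * P => energy z.1)}.
    exact: (@continuous_comp _ _ _ fst (@energy R d) z (@continuous_fst P P z) (cE z.1)).
  have cE2 z : {for z, continuous (fun z : P * P => energy z.2)}.
    exact: (@continuous_comp _ _ _ snd (@energy R d) z (@continuous_snd P P z) (cE z.2)).
  rewrite (_ : Psi = fun z => W z.1 z.2 + (- e) * (energy z.1 + energy z.2)).
    exact: (continuous_lin (c := - e) Wc (continuous_addr cE1 cE2)).
  by apply/funext => z; rewrite mulNr.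
have cPP : compact [set: P * P].
  by rewrite -setXTT; apply: compact_setX; exact: prob_setT_compact.
have [|[mu nu] _ hmin] := compact_EVT_min (ex_intro _ (mu1, nu1) Logic.I) cPP (f := Psi).
  exact: continuous_subspaceT.
have W0 : W mu nu <= W mu1 nu1 / 2.
  have /andP[h1 h2] := energy01 mu; have /andP[h3 h4] := energy01 nu.
  have /andP[h5 h6] := energy01 mu1; have /andP[h7 h8] := energy01 nu1.
  apply: (perturbed_value_arith (hmin (mu1, nu1) (mem_set Logic.I))) => //=.
  - by rewrite -[2]/(1 + 1) lerD.
  - exact: addr_ge0.
  - exact: ltW.
have e20 : 0 <= 2 * e by rewrite mulr_ge0// ltW.
have m1 : strict_min (fun m => W m nu - 2 * e * pairing (energy_grad mu) m) mu.
  apply: strict_min_perturbed => // m.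
  by have := hmin (m, nu) (mem_set Logic.I); rewrite /Psi/= !mulrDr !opprD !addrA lerD2r.
(* W is unchanged when both solutions and measures are exchanged, so the same minimiser tests [V] at
   [nu], with [U] at [mu] as test function. *)
have m2 : strict_min (fun m => pairing_sub (fun x => V x m - U x mu) m mu
    - 2 * e * pairing (energy_grad nu) m) nu.
  apply: (@strict_min_perturbed _ _ (fun m => pairing_sub (fun x => V x m - U x mu) m mu)) => // m.
  rewrite !Wsym.
  by have := hmin (mu, m) (mem_set Logic.I); rewrite /Psi/= !mulrDr [e * energy mu + _]addrC [e * energy mu + _]addrC !opprD !addrA lerD2r.
have I1 := solution_ineq sU (cV2 nu) (energy_grad_C2 mu) e20
  (energy_grad_tpderiv_le1 mu) (energy_grad_tlaplacian_le mu) (bCU mu) m1.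
have I2 := solution_ineq sV (cU2 mu) (energy_grad_C2 nu) e20
  (energy_grad_tpderiv_le1 nu) (energy_grad_tlaplacian_le nu) (bCV nu) m2.
(* The tangent inequality is taken at the gradient of the solution under test, where the drift of
   its own equation is evaluated: [U] at [mu], [V] at [nu]. *)
have cvx g h m : torusC2 g -> torusC2 h ->
    pairing (fun x => H x (tgrad g x)) m - pairing (fun x => H x (tgrad h x)) m <=
    pairing (fun x => dotp (tgrad g x - tgrad h x) (DpH H x (tgrad g x))) m.
  move=> cg ch.
  have cHg : continuous (fun x => H x (tgrad g x)).
    by apply: hamiltonian_continuous => //; exact: tgrad_pi_continuous.
  have cHh : continuous (fun x => H x (tgrad h x)).
    by apply: hamiltonian_continuous => //; exact: tgrad_pi_continuous.
  have cdot : continuous (fun x => dotp (tgrad g x - tgrad h x) (DpH H x (tgrad g x))).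
    apply: dotp_continuous => i; last by apply: DpH_continuous => //; exact: tgrad_pi_continuous.
    rewrite (_ : (fun _ => _) = fun x => tgrad g x ord0 i - tgrad h x ord0 i).
      by apply: continuous_subr; exact: tgrad_coord_continuous.
    by apply/funext => x; rewrite !mxE.
  rewrite -subr_le0 -pairingB// -pairingB//; last exact: continuous_subr.
  apply: pairing_le0 => [|x]; first by apply: continuous_subr => //; exact: continuous_subr.
  have := convex_gradient_le (tgrad h x) (H_convex x) (hamiltonian_differentiable HC1 x (tgrad g x)).
  rewrite -[\row_i _]/(DpH H x (tgrad g x)) -opprB -scaleN1r dotp_scalel mulN1r => hc.
  by rewrite subr_le0 lerBlDr -lerBlDl.
have cx1 := cvx _ _ mu (cU2 mu) (cV2 nu); have cx2 := cvx _ _ nu (cV2 nu) (cU2 mu).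
have fm := f_monotone mu nu.
have cf m := jointly_continuous_slice (m := m) f_continuous.
rewrite /pairing_sub !(pairingB _ (cf mu) (cf nu)) in fm.
have rW : r * W mu nu <= r * (W mu1 nu1 / 2) by rewrite ler_wpM2l// ltW.
rewrite WE in rW.
rewrite /pairing_sub -/K in I1 I2.
exact: (comparison_arith fm cx1 cx2 I1 I2 rW eK).
Qed.

End fixed_equation.

(** A single small [t] suffices: after division by [t], replacing [U] at the mixture by [U] at [nu]
    costs two errors of a quarter of [- dl], too little to make a negative value nonnegative. *)
Lemma eq_up_to_constant U V nu : jointly_continuous U -> (forall m, torusC2 (U ^~ m)) ->
  continuous (V ^~ nu) ->
  (forall mu, 0 <= pairing_sub (fun x => U x mu - V x nu) mu nu) ->
  forall eta, 0 <= pairing_sub (fun x => U x nu - V x nu) eta nu.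
Proof.
move=> cU cU2 cV hpos eta; rewrite leNgt; apply/negP => neg.
set dl := pairing_sub _ _ _ in neg.
have e0 : 0 < - dl / 4 by rewrite divr_gt0// oppr_gt0.
have cl m := jointly_continuous_slice (m := m) cU.
have := uniform_in_x nu cU e0; move=> /nbhs_ballP[e /= e1 he].
pose D : R := 2 * d%:R + 1.
have D0 : 0 < D by rewrite ltr_wpDl// mulr_ge0.
(* By [mixture_d1] the mixture is within [t * (2 * d)] of [nu], here at most [e / 2]. *)
pose t := Num.min 1 (e / 2 / D).
have t0 : 0 < t by rewrite lt_min ltr01 !divr_gt0.
have t1 : t <= 1 by rewrite ge_min lexx.
have t01 : 0 <= t <= 1 by rewrite t1 ltW.
have [m hm] := mixture_exists nu eta t01.
have bm : ball nu e m.
  apply: le_lt_trans (mixture_d1 t01 hm) _; rewrite lte_fin.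
  have : t <= e / 2 / D by rewrite ge_min lexx orbT.
  rewrite ler_pdivlMr// /D => tD; have := ltW t0; nra.
have hx := he m bm.
have cg : continuous (fun x => U x m - V x nu) by exact: continuous_subr.
have := hpos m; rewrite /pairing_sub hm// => h1.
have h2 : 0 <= t * (pairing (fun x => U x m - V x nu) eta - pairing (fun x => U x m - V x nu) nu).
  by apply: le_trans h1 _; rewrite le_eqVlt; apply/orP; left; apply/eqP; ring.
rewrite pmulr_rge0// in h2.
have cd : continuous (fun x => U x m - U x nu) by exact: continuous_subr.
have k q : `|pairing (fun x => U x m - U x nu) q| <= - dl / 4 by exact: pairing_norm_le.
have := k eta; have := k nu.
have dlE : dl = pairing (U ^~ nu) eta - pairing (V ^~ nu) eta -
  (pairing (U ^~ nu) nu - pairing (V ^~ nu) nu) by rewrite /dl /pairing_sub !pairingB.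
rewrite !pairingB// => k1 k2; rewrite !pairingB// in h2.
exact: (eq_up_to_constant_arith dlE neg h2 k1 k2).
Qed.

End monotone_solutions.

Lemma pairing_dirac (R : realType) (d : nat) (g : torus R d -> R) (x : torus R d) :
  continuous g -> pairing g (dirac x : prob R d) = g x.
Proof.
move=> cg; rewrite /pairing /Rintegral integral_dirac ?diracT ?mul1e//.
by apply/measurable_EFinP; exact: continuous_torus_measurable.
Qed.

Theorem theorem3p1 (R : realType) (d : nat) (r sigma : R)
    (H : torus R d -> 'rV[R]_d -> R) (f : torus R d -> prob R d -> R) :
  (1 < d)%N -> 0 < r -> 0 < sigma ->
  hamiltonianC1 H ->
  (forall x, convex_function [set: 'rV[R]_d] (H x)) ->
  jointly_continuous f -> monotone_map f ->
  (forall U V : torus R d -> prob R d -> R,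
     monotone_solution r sigma H f U -> monotone_solution r sigma H f V ->
     exists c : prob R d -> R, forall x m, U x m = V x m + c m) /\
  (forall U : torus R d -> prob R d -> R,
     monotone_solution r sigma H f U -> monotone_map U).
Proof.
move=> _ r0 sigma0 HC1 Hcvx cf fmon; split => [U V sU sV|U sU mu nu]; last first.
  exact: (comparison sigma0 HC1 cf r0 Hcvx fmon sU sU).
have hUV := comparison sigma0 HC1 cf r0 Hcvx fmon sU sV.
have hVU := comparison sigma0 HC1 cf r0 Hcvx fmon sV sU.
have [[cU cU2 _] _] := sU; have [[cV cV2 _] _] := sV.
have slU m := jointly_continuous_slice (m := m) cU.
have slV m := jointly_continuous_slice (m := m) cV.
(* The two inequalities at a Dirac mass say that U - V at [x] equals its mean under [m]; that mean
   is the constant. *)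
exists (fun m => pairing (U ^~ m) m - pairing (V ^~ m) m) => x m.
have := eq_up_to_constant cU cU2 (slV m) (hUV^~ m) (dirac x).
have := eq_up_to_constant cV cV2 (slU m) (hVU^~ m) (dirac x).
rewrite /pairing_sub !pairingB// !pairing_dirac// => h1 h2.
by apply/eqP; rewrite eq_le; apply/andP; split; lra.
Qed.
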